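(* For the problem $u_{xt}+uu_{xx}-\lambda u_x^2=-(\lambda+1)\int_0^1u_x^2\,dx$, $u(x,0)=u_0(x)$, with $1$-periodic boundary conditions, there exist $1$-periodic initial data $u_0$ with $u_0'$ continuous, mean zero, and $u_0''$ piecewise constant, such that: for every $\lambda\in(1/2,+\infty)$ there is a finite $t_*>0$ with $M(t)\to+\infty$ as $t\uparrow t_*$ and $u_x(\gamma(\alpha,t),t)\to-\infty$ for every $\alpha$ other than the maximum point of $u_0'$ (two-sided, everywhere blow-up); and for every $\lambda\in(-\infty,0)$ there is a finite $t_*>0$ with $m(t)\to-\infty$ as $t\uparrow t_*$, the divergence occurring at the finitely many points where $u_0'$ attains its minimum.
   Context: $\gamma(\alpha,t)$ is the characteristic: $\dot\gamma=u(\gamma,t)$, $\gamma(\alpha,0)=\alpha$; $M(t)=\sup_\alpha u_x(\gamma(\alpha,t),t)$, $m(t)=\inf_\alpha u_x(\gamma(\alpha,t),t)$. *)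

(* Defs.v *)
From Stdlib Require Import Reals List.
Open Scope R_scope.

Definition periodic1 (f : R -> R) : Prop := forall x, f (x + 1) = f x.

Definition cont2_on (f : R -> R -> R) (ts : R) : Prop :=
  forall x t, 0 <= t < ts -> forall eps, eps > 0 ->
    exists d, d > 0 /\ forall y s, 0 <= s < ts -> Rabs (y - x) < d ->
      Rabs (s - t) < d -> Rabs (f y s - f x t) < eps.

Definition pw_const_deriv (g : R -> R) : Prop :=
  exists (n : nat) (p c : nat -> R),
    p 0%nat = 0 /\ p n = 1 /\
    (forall i, (i < n)%nat -> p i < p (S i)) /\
    (forall i x, (i < n)%nat -> p i < x < p (S i) -> derivable_pt_lim g x (c i)).

Definition admissible_data (u0 u0p : R -> R) : Prop :=
  periodic1 u0 /\
  (forall x, derivable_pt_lim u0 x (u0p x)) /\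
  continuity u0p /\
  (exists pr : Riemann_integrable u0 0 1, RiemannInt pr = 0) /\
  pw_const_deriv u0p.

(* (u, ux, gam) is a solution on [0,ts) of
     u_xt + u u_xx - lam u_x^2 = -(lam+1) \int_0^1 u_x^2 dx,  u(x,0)=u0(x),
   1-periodic in x, with ux = u_x, gam the characteristics
   (d/dt gam = u(gam,t), gam(a,0)=a); the PDE is imposed in its
   characteristic form  d/dt [u_x(gam(a,t),t)] = lam u_x^2 - (lam+1) I(t),
   since (u_x)_t + u (u_x)_x is the derivative of u_x along characteristics
   (u_xx need not exist at the kinks of piecewise-smooth data). *)
Definition is_solution (lam : R) (u0 : R -> R) (ts : R)
    (u ux gam : R -> R -> R) : Prop :=
  (forall x, u x 0 = u0 x) /\
  (forall t, 0 <= t < ts -> forall x, u (x + 1) t = u x t) /\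
  (forall t, 0 <= t < ts -> forall x,
      derivable_pt_lim (fun y => u y t) x (ux x t)) /\
  cont2_on u ts /\ cont2_on ux ts /\
  (forall a, gam a 0 = a) /\
  (forall a t, 0 < t < ts ->
      derivable_pt_lim (fun s => gam a s) t (u (gam a t) t)) /\
  (forall a eps, eps > 0 -> exists d, d > 0 /\
      forall s, 0 <= s < ts -> s < d -> Rabs (gam a s - a) < eps) /\
  exists I : R -> R,
    (forall t, 0 <= t < ts -> exists pr : Riemann_integrable
        (fun x => (ux x t) ^ 2) 0 1, RiemannInt pr = I t) /\
    (forall a t, 0 < t < ts ->
      derivable_pt_lim (fun s => ux (gam a s) s) t
        (lam * (ux (gam a t) t) ^ 2 - (lam + 1) * I t)).

Definition to_minf_left (f : R -> R) (ts : R) : Prop :=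
  forall K, exists d, d > 0 /\
    forall t, 0 <= t -> ts - d < t < ts -> f t < K.

(* M(t) = sup_a ux(gam(a,t),t) -> +oo as t increases to ts *)
Definition M_to_pinf (ux gam : R -> R -> R) (ts : R) : Prop :=
  forall K, exists d, d > 0 /\
    forall t, 0 <= t -> ts - d < t < ts ->
      exists a, ux (gam a t) t > K.

(* m(t) = inf_a ux(gam(a,t),t) -> -oo as t increases to ts *)
Definition m_to_minf (ux gam : R -> R -> R) (ts : R) : Prop :=
  forall K, exists d, d > 0 /\
    forall t, 0 <= t -> ts - d < t < ts ->
      exists a, ux (gam a t) t < K.

(* Main.v *)
(* Along a characteristic the equation is a Riccati equation, and the substitution
     J = 1 - lam eta u0'(a),  F(eta) = int_0^1 J^(-1/lam) da,  dt/d eta = F^(2 lam)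
   solves it: gamma_a = J^(-1/lam) / F and
     u_x(gamma(a,t),t) = F^(-2 lam) (u0'(a)/J - F'/F).
   Take for u0' the triangle wave 1 - 4 dist(x,Z), which is uniformly distributed on [-1,1].
   The solution lives for |lam| eta < 1; put s = |lam| eta.  If lam > 1/2, then
   F = O((1-s)^(r-1/lam)) for some r with 2/(2 lam+1) < r < min(1,1/lam).  This makes F^(2 lam)
   integrable, so that the blow-up time is finite, and it shows that both u_x at the
   maximum and F'/F^(1+2 lam) ~ (1-s)^(-1/lam)/F^(1+2 lam) are unbounded; away from the
   maximum the latter wins, as u0'/J stays bounded.  If lam < 0, then F lies between positive
   constants and F' is bounded, so u_x is unbounded exactly where J vanishes in the limit. *)
Require Import Defs.
From Stdlib Require Import Reals List.
From Stdlib Require Import Lra Lia ZArith ClassicalEpsilon.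
From Coquelicot Require Import Coquelicot.
Open Scope R_scope.

(** Sharp asymptotics of F as s tends to 1 would split into lam < 1, lam = 1 (a logarithm) and lam >
    1; the lossy exponent r treats the three cases at once. The bound r < 1 keeps the integral of
    J^(-r) bounded uniformly in s; r < 1/lam makes r - 1/lam negative, so that J >= 1 - s controls
    the remaining factor; r (2 lam + 1) > 2 is what divergence away from the maximum demands, and
    with r < 1 it yields 2 lam r > 1, the condition for finite time and for divergence at the
    maximum. For lam > 0 these bounds are compatible exactly when lam > 1/2. Exact identities
    replace asymptotic expansions: J is affine in the label on each half period, so integrals of its
    powers are explicit. Since the datum has corners, everything is built in labels; u and u_x are
    then defined by composition with the inverse of gamma, whose joint continuity comes from
    monotonicity in the label. *)

(** * Distance to the integers and the triangle wave *)

Definition distZ (x : R) : R := Rmin (frac_part x) (1 - frac_part x).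

(** Together with [distZ_attained] this characterises [distZ] as a minimum over the integers, so
    that the Lipschitz bound, periodicity and reflection follow without case analysis on
    [frac_part]. *)
Lemma distZ_le (x : R) (k : Z) : distZ x <= Rabs (x - IZR k).
Proof.
  unfold distZ, frac_part.
  destruct (base_Int_part x) as [H1 H2].
  destruct (Z_le_gt_dec k (Int_part x)) as [Hk | Hk].
  - apply IZR_le in Hk.
    apply Rle_trans with (1 := Rmin_l _ _), Rle_trans with (2 := Rle_abs _). lra.
  - assert (Hk' : (Int_part x + 1 <= k)%Z) by lia.
    apply IZR_le in Hk'. rewrite plus_IZR in Hk'.
    apply Rle_trans with (1 := Rmin_r _ _).
    rewrite Rabs_minus_sym. apply Rle_trans with (2 := Rle_abs _). lra.
Qed.

Lemma distZ_attained (x : R) : exists k : Z, distZ x = Rabs (x - IZR k).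
Proof.
  unfold distZ, frac_part.
  destruct (base_Int_part x) as [H1 H2].
  unfold Rmin; destruct Rle_dec.
  - exists (Int_part x). rewrite Rabs_pos_eq; lra.
  - exists (Int_part x + 1)%Z. rewrite plus_IZR, Rabs_left1; lra.
Qed.

Lemma distZ_bounds (x : R) : 0 <= distZ x <= 1 / 2.
Proof.
  unfold distZ, frac_part.
  destruct (base_Int_part x) as [H1 H2].
  unfold Rmin; destruct Rle_dec; lra.
Qed.

Lemma distZ_near (x : R) (k : Z) : Rabs (x - IZR k) <= 1 / 2 -> distZ x = Rabs (x - IZR k).
Proof.
  intros Hx. apply Rle_antisym; [apply distZ_le |].
  destruct (distZ_attained x) as [j Hj]. rewrite Hj.
  destruct (Z.eq_dec j k) as [-> | Hjk]; [lra |].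
  assert (H1 : 1 <= Rabs (IZR j - IZR k)).
  { rewrite <- minus_IZR, <- abs_IZR. apply IZR_le. lia. }
  assert (H2 := Rabs_triang (IZR j - x) (x - IZR k)).
  rewrite (Rabs_minus_sym (IZR j) x) in H2.
  replace (IZR j - x + (x - IZR k)) with (IZR j - IZR k) in H2 by ring. lra.
Qed.

Definition tri (x : R) : R := 1 - 4 * distZ x.

Lemma tri_bounds (x : R) : -1 <= tri x <= 1.
Proof. unfold tri. assert (H := distZ_bounds x). lra. Qed.

Lemma distZ_lip (x y : R) : Rabs (distZ x - distZ y) <= Rabs (x - y).
Proof.
  assert (H : forall a b, distZ a - distZ b <= Rabs (a - b)).
  { intros a b. destruct (distZ_attained b) as [k Hk].
    assert (H1 := distZ_le a k). assert (H2 := Rabs_triang (a - b) (b - IZR k)).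
    replace (a - b + (b - IZR k)) with (a - IZR k) in H2 by ring. lra. }
  apply Rabs_le. assert (H1 := H x y). assert (H2 := H y x).
  rewrite Rabs_minus_sym in H2. lra.
Qed.

Lemma tri_continuity : continuity tri.
Proof.
  intros x eps Heps. exists (eps / 4). split; [lra |].
  intros y [_ Hy]. simpl in *. unfold R_dist in *.
  unfold tri. replace (1 - 4 * distZ y - (1 - 4 * distZ x)) with (- (4 * (distZ y - distZ x))) by ring.
  rewrite Rabs_Ropp, Rabs_mult, (Rabs_pos_eq 4) by lra.
  assert (H := distZ_lip y x). lra.
Qed.

Lemma tri_continuous (x : R) : continuous tri x.
Proof. apply continuity_pt_filterlim, tri_continuity. Qed.

Lemma tri_add1 (x : R) : tri (x + 1) = tri x.
Proof.
  unfold tri. f_equal. f_equal. apply Rle_antisym.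
  - destruct (distZ_attained x) as [k ->].
    replace (x - IZR k) with (x + 1 - IZR (k + 1)) by (rewrite plus_IZR; ring).
    apply distZ_le.
  - destruct (distZ_attained (x + 1)) as [k ->].
    replace (x + 1 - IZR k) with (x - IZR (k - 1)) by (rewrite minus_IZR; ring).
    apply distZ_le.
Qed.

Lemma tri_left (x : R) : 0 <= x <= 1 / 2 -> tri x = 1 - 4 * x.
Proof.
  intros Hx. unfold tri. rewrite (distZ_near x 0); rewrite Rabs_pos_eq; lra.
Qed.

Lemma tri_refl (x : R) : tri (1 - x) = tri x.
Proof.
  unfold tri. f_equal. f_equal. apply Rle_antisym.
  - destruct (distZ_attained x) as [k ->].
    rewrite Rabs_minus_sym. replace (IZR k - x) with (1 - x - IZR (1 - k)) by (rewrite minus_IZR; ring).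
    apply distZ_le.
  - destruct (distZ_attained (1 - x)) as [k ->].
    rewrite Rabs_minus_sym. replace (IZR k - (1 - x)) with (x - IZR (1 - k)) by (rewrite minus_IZR; ring).
    apply distZ_le.
Qed.

Lemma tri_IZR (k : Z) : tri (IZR k) = 1.
Proof.
  unfold tri. rewrite (distZ_near _ k); rewrite Rminus_diag, Rabs_R0; lra.
Qed.

Lemma tri_eq_1 (x : R) : tri x = 1 -> exists k : Z, x = IZR k.
Proof.
  unfold tri. intros H. destruct (distZ_attained x) as [k Hk].
  exists k. assert (H0 : Rabs (x - IZR k) = 0) by lra.
  apply Rminus_diag_uniq. now apply Rabs_eq_0.
Qed.

Lemma tri_half (k : Z) : tri (1 / 2 + IZR k) = -1.
Proof.
  unfold tri. rewrite (distZ_near _ k);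
    replace (1 / 2 + IZR k - IZR k) with (1 / 2) by ring; rewrite Rabs_pos_eq; lra.
Qed.

Lemma tri_eq_m1 (x : R) : tri x = -1 -> exists k : Z, x = 1 / 2 + IZR k.
Proof.
  unfold tri, distZ, frac_part. intros H. exists (Int_part x).
  revert H. unfold Rmin. destruct Rle_dec; lra.
Qed.

(** * Integrals of powers of the Jacobian and their dependence on the parameter *)

Definition jac (lam eta a : R) : R := 1 - lam * eta * tri a.

Lemma jac_bounds (lam eta a : R) :
  1 - Rabs (lam * eta) <= jac lam eta a <= 1 + Rabs (lam * eta).
Proof.
  unfold jac. assert (H : Rabs (lam * eta * tri a) <= Rabs (lam * eta)).
  { rewrite Rabs_mult. rewrite <- (Rmult_1_r (Rabs (lam * eta))) at 2.
    apply Rmult_le_compat_l; [apply Rabs_pos |].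
    apply Rabs_le. apply tri_bounds. }
  apply Rabs_le_between in H. lra.
Qed.

Lemma jac_pos (lam eta a : R) : Rabs (lam * eta) < 1 -> 0 < jac lam eta a.
Proof. intros H. assert (H1 := jac_bounds lam eta a). lra. Qed.

(** A family closed under differentiation in [eta], which lowers [p] by one and raises [j] by one;
    F, F', F'' and their partial integrals in the label all come from it. *)
Definition kern (lam p : R) (j : nat) (eta a : R) : R :=
  tri a ^ j * Rpower (jac lam eta a) p.

Lemma Rpower_pos (x y : R) : 0 < Rpower x y.
Proof. apply exp_pos. Qed.

Lemma Rpower_pred (x p : R) : 0 < x -> Rpower x (p - 1) = Rpower x p / x.
Proof.
  intros Hx. unfold Rminus. rewrite Rpower_plus, Rpower_Ropp, Rpower_1 by trivial. reflexivity.
Qed.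

Lemma kern_derive (lam p : R) (j : nat) (eta a : R) : Rabs (lam * eta) < 1 ->
  is_derive (fun z => kern lam p j z a) eta (- lam * p * kern lam (p - 1) (S j) eta a).
Proof.
  intros H. assert (HJ := jac_pos lam eta a H). unfold kern.
  rewrite Rpower_pred by trivial. unfold Rpower, jac in *. auto_derive; [lra |].
  simpl. unfold Rminus. field. lra.
Qed.

Lemma kern_cont2 (lam p : R) (j : nat) (eta a : R) : Rabs (lam * eta) < 1 ->
  continuity_2d_pt (kern lam p j) eta a.
Proof.
  intros H. assert (HJ := jac_pos lam eta a H).
  assert (Ht : continuity_2d_pt (fun _ y => tri y) eta a).
  { apply (continuity_1d_2d_pt_comp tri (fun _ y => y)).
    apply tri_continuity. apply continuity_2d_pt_id2. }
  unfold kern. apply continuity_2d_pt_mult.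
  - apply (continuity_1d_2d_pt_comp (fun y => y ^ j) (fun _ y => tri y)); trivial.
    apply derivable_continuous_pt, derivable_pt_pow.
  - apply (continuity_1d_2d_pt_comp (fun y => Rpower y p) (jac lam)).
    + apply derivable_continuous_pt. eexists. apply derivable_pt_lim_power. trivial.
    + unfold jac. apply continuity_2d_pt_minus; [apply continuity_2d_pt_const |].
      apply continuity_2d_pt_mult; trivial.
      apply continuity_2d_pt_mult; [apply continuity_2d_pt_const | apply continuity_2d_pt_id1].
Qed.

Lemma continuity_2d_pt_snd (f : R -> R -> R) (x y : R) :
  continuity_2d_pt f x y -> continuous (f x) y.
Proof.
  intros H. apply continuity_pt_filterlim. intros eps Heps.
  destruct (H (mkposreal eps Heps)) as [d Hd]. exists d. split; [apply cond_pos |].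
  intros z [_ Hz]. simpl in *. apply Hd; trivial.
  rewrite Rminus_diag, Rabs_R0. apply cond_pos.
Qed.

Lemma continuity_2d_pt_fst (f : R -> R -> R) (x y : R) :
  continuity_2d_pt f x y -> continuous (fun z => f z y) x.
Proof.
  intros H. apply continuity_pt_filterlim. intros eps Heps.
  destruct (H (mkposreal eps Heps)) as [d Hd]. exists d. split; [apply cond_pos |].
  intros z [_ Hz]. simpl in *. apply Hd; trivial.
  rewrite Rminus_diag, Rabs_R0. apply cond_pos.
Qed.

Lemma kern_continuous (lam p : R) (j : nat) (eta a : R) : Rabs (lam * eta) < 1 ->
  continuous (kern lam p j eta) a.
Proof. intros H. now apply continuity_2d_pt_snd, kern_cont2. Qed.

Lemma kern_ex_RInt (lam p : R) (j : nat) (eta a b : R) : Rabs (lam * eta) < 1 ->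
  ex_RInt (kern lam p j eta) a b.
Proof.
  intros H. apply (ex_RInt_continuous (V := R_CompleteNormedModule)). intros; now apply kern_continuous.
Qed.

Lemma locally_small (lam eta : R) : Rabs (lam * eta) < 1 ->
  locally eta (fun z => Rabs (lam * z) < 1).
Proof.
  intros H.
  assert (Hc : continuous (fun z => Rabs (lam * z)) eta).
  { apply (continuous_comp (fun z => lam * z) Rabs).
    - apply (continuous_mult (fun _ => lam) (fun z => z)); [apply continuous_const | apply continuous_id].
    - apply continuous_Rabs. }
  apply (Hc (fun y => y < 1)). now apply open_lt.
Qed.

Definition kint (lam p : R) (j : nat) (eta a : R) : R := RInt (kern lam p j eta) 0 a.

Lemma kint_derive_a (lam p : R) (j : nat) (eta a : R) : Rabs (lam * eta) < 1 ->
  is_derive (kint lam p j eta) a (kern lam p j eta a).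
Proof.
  intros H. apply (is_derive_RInt (kern lam p j eta) _ 0).
  - apply filter_forall. intros b. apply (RInt_correct (V := R_CompleteNormedModule)). now apply kern_ex_RInt.
  - now apply kern_continuous.
Qed.

(** Agreement is asked near [x] but for every second argument, because the smallness condition on
    [lam * eta] restricts the first variable only. *)
Lemma continuity_2d_pt_ext_near (f g : R -> R -> R) (x y : R) :
  locally x (fun z => forall w, f z w = g z w) ->
  continuity_2d_pt g x y -> continuity_2d_pt f x y.
Proof.
  intros [d Hd] Hg. apply continuity_2d_pt_ext_loc with g; trivial.
  exists d. intros u w Hu _. symmetry. now apply Hd.
Qed.

(** Differentiation under the integral sign; the derivative of the integrand is again a [kern], so
    the joint continuity that this requires is [kern_cont2]. *)
Lemma kint_derive_eta (lam p : R) (j : nat) (eta a : R) : Rabs (lam * eta) < 1 ->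
  is_derive (fun z => kint lam p j z a) eta (- lam * p * kint lam (p - 1) (S j) eta a).
Proof.
  intros H. unfold kint.
  assert (Hl := locally_small lam eta H).
  rewrite <- (RInt_scal (V := R_CompleteNormedModule)) by now apply kern_ex_RInt.
  rewrite (RInt_ext _ (fun t => Derive (fun u => kern lam p j u t) eta)).
  - apply is_derive_RInt_param.
    + revert Hl. apply filter_imp. intros z Hz t _. eexists. now apply kern_derive.
    + intros t _. apply continuity_2d_pt_ext_near with
        (fun u v => - lam * p * kern lam (p - 1) (S j) u v).
      * revert Hl. apply filter_imp. intros z Hz w. apply is_derive_unique. now apply kern_derive.
      * apply continuity_2d_pt_mult; [apply continuity_2d_pt_const | now apply kern_cont2].
    + revert Hl. apply filter_imp. intros z Hz. now apply kern_ex_RInt.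
  - intros t _. symmetry. apply is_derive_unique. now apply kern_derive.
Qed.

(* The part of the increment coming from the moving endpoint is controlled by a local bound on the integrand. *)
Lemma continuity_2d_pt_RInt (f : R -> R -> R) (x a : R) :
  continuity_2d_pt f x a ->
  locally x (fun z => forall b c, ex_RInt (f z) b c) ->
  continuous (fun z => RInt (f z) 0 a) x ->
  continuity_2d_pt (fun z b => RInt (f z) 0 b) x a.
Proof.
  intros Hf [d1 Hd1] Hc eps.
  destruct (Hf (mkposreal 1 Rlt_0_1)) as [d2 Hd2].
  apply continuity_pt_filterlim in Hc.
  destruct (Hc (eps / 2)) as [d3 [Hd3 Hd3']]; [assert (H := cond_pos eps); lra |].
  set (B := Rabs (f x a) + 1).
  assert (HB : 0 < B) by (unfold B; assert (H := Rabs_pos (f x a)); lra).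
  assert (He : 0 < eps / (2 * B)) by (apply Rdiv_lt_0_compat; [apply cond_pos | lra]).
  assert (Hd : 0 < Rmin (Rmin d1 d2) (Rmin d3 (eps / (2 * B)))).
  { apply Rmin_pos; apply Rmin_pos; trivial; apply cond_pos. }
  exists (mkposreal _ Hd). simpl. intros u b Hu Hb.
  assert (M1 := Rmin_l (Rmin d1 d2) (Rmin d3 (eps / (2 * B)))).
  assert (M2 := Rmin_r (Rmin d1 d2) (Rmin d3 (eps / (2 * B)))).
  assert (M3 := Rmin_l d1 d2). assert (M4 := Rmin_r d1 d2).
  assert (M5 := Rmin_l d3 (eps / (2 * B))). assert (M6 := Rmin_r d3 (eps / (2 * B))).
  assert (Hex : forall c e, ex_RInt (f u) c e).
  { apply Hd1. unfold ball; simpl; unfold AbsRing_ball, abs, minus, plus, opp; simpl. fold (u - x). lra. }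
  assert (E : RInt (f u) 0 b = RInt (f u) 0 a + RInt (f u) a b).
  { symmetry. apply (RInt_Chasles (V := R_CompleteNormedModule)); apply Hex. }
  rewrite E.
  assert (E1 : Rabs (RInt (f u) a b) < eps / 2).
  { apply Rle_lt_trans with (B * Rabs (b - a)).
    - assert (Hpt : forall t, Rmin a b <= t <= Rmax a b -> Rabs (f u t) <= B).
      { intros t Ht. assert (Hta : Rabs (t - a) < d2).
        { apply Rle_lt_trans with (Rabs (b - a)); [| lra].
          revert Ht. unfold Rmin, Rmax. destruct Rle_dec; unfold Rabs; repeat destruct Rcase_abs; lra. }
        assert (Hux : Rabs (u - x) < d2) by lra.
        assert (H := Hd2 u t Hux Hta). simpl in H. unfold B.
        assert (H' := Rabs_triang_inv (f u t) (f x a)). lra. }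
      destruct (Rle_dec a b) as [Hab | Hab].
      + rewrite (Rabs_pos_eq (b - a)) by lra. rewrite (Rmult_comm B).
        apply abs_RInt_le_const; trivial; try apply Hex.
        intros t Ht. apply Hpt. rewrite Rmin_left, Rmax_right by lra. trivial.
      + rewrite (Rabs_left1 (b - a)) by lra.
        rewrite <- (opp_RInt_swap (V := R_CompleteNormedModule)) by apply Hex.
        change (Rabs (- RInt (f u) b a) <= B * - (b - a)).
        rewrite Rabs_Ropp, (Rmult_comm B). replace (- (b - a)) with (a - b) by ring.
        apply abs_RInt_le_const; [lra | apply Hex |].
        intros t Ht. apply Hpt. rewrite Rmin_right, Rmax_left by lra. trivial.
    - apply Rlt_le_trans with (B * (eps / (2 * B))).
      + apply Rmult_lt_compat_l; lra.
      + right. field. lra. }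
  assert (E2 : Rabs (RInt (f u) 0 a - RInt (f x) 0 a) < eps / 2).
  { destruct (Req_dec u x) as [-> | Hne].
    - rewrite Rminus_diag, Rabs_R0. assert (H := cond_pos eps). lra.
    - apply (Hd3' u). split; [split; [exact I | auto] |]. simpl. unfold R_dist. lra. }
  replace (RInt (f u) 0 a + RInt (f u) a b - RInt (f x) 0 a)
    with (RInt (f u) 0 a - RInt (f x) 0 a + RInt (f u) a b) by ring.
  apply Rle_lt_trans with (1 := Rabs_triang _ _). lra.
Qed.

Lemma kint_cont2 (lam p : R) (j : nat) (eta a : R) : Rabs (lam * eta) < 1 ->
  continuity_2d_pt (kint lam p j) eta a.
Proof.
  intros H. unfold kint. apply (continuity_2d_pt_RInt (kern lam p j)).
  - now apply kern_cont2.
  - assert (Hl := locally_small lam eta H). revert Hl. apply filter_imp.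
    intros z Hz b c. now apply kern_ex_RInt.
  - apply (ex_derive_continuous (fun z => kint lam p j z a)). eexists. now apply kint_derive_eta.
Qed.

Lemma kern_add1 (lam p : R) (j : nat) (eta a : R) : kern lam p j eta (a + 1) = kern lam p j eta a.
Proof. unfold kern, jac. now rewrite tri_add1. Qed.

Lemma kint_add1 (lam p : R) (j : nat) (eta a : R) : Rabs (lam * eta) < 1 ->
  kint lam p j eta (a + 1) = kint lam p j eta a + kint lam p j eta 1.
Proof.
  intros H. unfold kint.
  rewrite <- (RInt_Chasles (V := R_CompleteNormedModule) (kern lam p j eta) 0 1 (a + 1)) by now apply kern_ex_RInt.
  rewrite Rplus_comm. change plus with Rplus. f_equal.
  assert (E := RInt_comp_lin (kern lam p j eta) 1 1 0 a).
  replace (1 * 0 + 1) with 1 in E by ring. replace (1 * a + 1) with (a + 1) in E by ring.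
  rewrite <- E by now apply kern_ex_RInt.
  apply RInt_ext. intros y _. change (1 * kern lam p j eta (1 * y + 1) = kern lam p j eta y).
  rewrite !Rmult_1_l. apply kern_add1.
Qed.

Lemma kint_0 (lam p : R) (j : nat) (eta : R) : kint lam p j eta 0 = 0.
Proof. apply (RInt_point (V := R_CompleteNormedModule)). Qed.

(* F, F' and F''/(1 + lam); below, [flow] is gamma, [vel] is u(gamma,t), [slope] is u_x(gamma,t),
   all with eta as the time variable, and [label] is the inverse of [flow] in a. *)
Definition wt (lam eta : R) : R := kint lam (- / lam) 0 eta 1.

Definition wt1 (lam eta : R) : R := kint lam (- / lam - 1) 1 eta 1.

Definition wt2 (lam eta : R) : R := kint lam (- / lam - 2) 2 eta 1.

Definition flow (lam eta a : R) : R := kint lam (- / lam) 0 eta a / wt lam eta.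

Definition vel (lam eta a : R) : R :=
  Rpower (wt lam eta) (- 2 * lam) *
  (kint lam (- / lam - 1) 1 eta a / wt lam eta
   - kint lam (- / lam) 0 eta a * wt1 lam eta / wt lam eta ^ 2).

Definition slope (lam eta a : R) : R :=
  Rpower (wt lam eta) (- 2 * lam) * (tri a / jac lam eta a - wt1 lam eta / wt lam eta).

(** The integral of u_x^2 over a period: F^(-4 lam) times the variance of u0'/J under the
    probability density J^(-1/lam)/F, whose mean is F'/F. *)
Definition energy (lam eta : R) : R :=
  Rpower (wt lam eta) (- 2 * lam) ^ 2 *
  (wt2 lam eta / wt lam eta - wt1 lam eta ^ 2 / wt lam eta ^ 2).

(** * Derivatives of the weight, the flow, the velocity and the slope *)

Lemma kern_0_pos (lam p eta a : R) : 0 < kern lam p 0 eta a.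
Proof. unfold kern. simpl. rewrite Rmult_1_l. apply Rpower_pos. Qed.

Lemma wt_pos (lam eta : R) : Rabs (lam * eta) < 1 -> 0 < wt lam eta.
Proof.
  intros H. apply RInt_gt_0; [lra | |].
  - intros; apply kern_0_pos.
  - intros; now apply kern_continuous.
Qed.

Lemma wt_derive (lam eta : R) : lam <> 0 -> Rabs (lam * eta) < 1 ->
  is_derive (wt lam) eta (wt1 lam eta).
Proof.
  intros Hl H. assert (D := kint_derive_eta lam (- / lam) 0 eta 1 H).
  replace (- lam * - / lam) with 1 in D by now field. rewrite Rmult_1_l in D. exact D.
Qed.

Lemma wt1_derive (lam eta : R) : lam <> 0 -> Rabs (lam * eta) < 1 ->
  is_derive (wt1 lam) eta ((1 + lam) * wt2 lam eta).
Proof.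
  intros Hl H. assert (D := kint_derive_eta lam (- / lam - 1) 1 eta 1 H).
  replace (- lam * (- / lam - 1)) with (1 + lam) in D by now field.
  replace (- / lam - 1 - 1) with (- / lam - 2) in D by ring. exact D.
Qed.

Lemma wt_Rpower_derive (lam p eta : R) : lam <> 0 -> Rabs (lam * eta) < 1 ->
  is_derive (fun z => Rpower (wt lam z) p) eta
    (p * Rpower (wt lam eta) p * (wt1 lam eta / wt lam eta)).
Proof.
  intros Hl H. assert (W := wt_pos lam eta H).
  evar_last.
  - apply (is_derive_comp (fun y => Rpower y p) (wt lam)).
    + apply is_derive_Reals, derivable_pt_lim_power; trivial.
    + now apply wt_derive.
  - rewrite Rpower_pred by trivial. unfold scal; simpl; unfold mult; simpl. field. lra.
Qed.

Lemma is_derive_mul_const (f : R -> R) (x l c : R) :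
  is_derive f x l -> is_derive (fun y => f y * c) x (l * c).
Proof. intros H. apply (is_derive_scal_l (V := R_NormedModule) f x l c H). Qed.

Lemma flow_derive_a (lam eta a : R) : Rabs (lam * eta) < 1 ->
  is_derive (flow lam eta) a (Rpower (jac lam eta a) (- / lam) / wt lam eta).
Proof.
  intros H. unfold flow, Rdiv. assert (D := kint_derive_a lam (- / lam) 0 eta a H).
  evar_last.
  - apply is_derive_mul_const. exact D.
  - unfold kern, scal; simpl; unfold mult; simpl. ring.
Qed.

Lemma Rpower_opp_r (x y z : R) : y = - z -> Rpower x y * Rpower x z = 1.
Proof.
  intros ->. rewrite <- Rpower_plus. replace (- z + z) with 0 by ring. unfold Rpower.
  rewrite Rmult_0_l. apply exp_0.
Qed.

(** [vel] is the quotient-rule derivative of [flow] multiplied by d eta/dt = F^(-2 lam); the factor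
    F^(2 lam) here undoes that and will cancel against the derivative of the time change. *)
Lemma flow_derive_eta (lam eta a : R) : lam <> 0 -> Rabs (lam * eta) < 1 ->
  is_derive (fun z => flow lam z a) eta (Rpower (wt lam eta) (2 * lam) * vel lam eta a).
Proof.
  intros Hl H. assert (W := wt_pos lam eta H).
  assert (D := kint_derive_eta lam (- / lam) 0 eta a H).
  assert (D1 := wt_derive lam eta Hl H).
  evar_last.
  - apply is_derive_div; [exact D | exact D1 | lra].
  - unfold vel. rewrite <- Rmult_assoc, (Rmult_comm (Rpower _ _)), Rpower_opp_r by ring.
    field. split; lra.
Qed.

(** The second factor is the label derivative of [flow]. Dividing by it, which is what composition
    with [label] does, leaves u_x equal to [slope]. *)
Lemma vel_derive_a (lam eta a : R) : Rabs (lam * eta) < 1 ->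
  is_derive (vel lam eta) a
    (slope lam eta a * (Rpower (jac lam eta a) (- / lam) / wt lam eta)).
Proof.
  intros H. assert (W := wt_pos lam eta H). assert (J := jac_pos lam eta a H).
  assert (D0 := kint_derive_a lam (- / lam) 0 eta a H).
  assert (D1 := kint_derive_a lam (- / lam - 1) 1 eta a H).
  unfold vel. unfold Rdiv, Rminus.
  evar_last.
  - apply is_derive_scal.
    apply (is_derive_plus (fun y => kint lam (- / lam - 1) 1 eta y * / wt lam eta)
       (fun y => - (kint lam (- / lam) 0 eta y * wt1 lam eta * / wt lam eta ^ 2))).
    + apply is_derive_mul_const. exact D1.
    + apply (is_derive_opp (fun y => kint lam (- / lam) 0 eta y * wt1 lam eta * / wt lam eta ^ 2)).
      do 2 apply is_derive_mul_const. exact D0.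
  - unfold slope, kern. rewrite Rpower_pred by trivial.
    unfold scal, plus, opp; simpl; unfold mult; simpl. field. split; lra.
Qed.

(** The quotient v = u0'/J satisfies dv/d eta = lam v^2. Differentiating the prefactor F^(-2 lam)
    produces the cross term -2 lam v F'/F, which completes the square in v - F'/F; what remains does
    not depend on the label and is -(lam + 1) times the variance in [energy]. *)
Lemma slope_derive_eta (lam eta a : R) : lam <> 0 -> Rabs (lam * eta) < 1 ->
  is_derive (fun z => slope lam z a) eta
    (Rpower (wt lam eta) (2 * lam) *
     (lam * slope lam eta a ^ 2 - (lam + 1) * energy lam eta)).
Proof.
  intros Hl H. assert (W := wt_pos lam eta H). assert (J := jac_pos lam eta a H).
  assert (D0 := wt_derive lam eta Hl H).
  assert (D1 := wt1_derive lam eta Hl H).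
  assert (DP := wt_Rpower_derive lam (- 2 * lam) eta Hl H).
  assert (P := Rpower_opp_r (wt lam eta) (- 2 * lam) (2 * lam) ltac:(ring)).
  assert (D2 : is_derive (fun z => tri a / jac lam z a) eta (lam * tri a ^ 2 / jac lam eta a ^ 2)).
  { unfold jac in *. auto_derive; [lra |]. unfold Rminus. field. lra. }
  assert (D3 := is_derive_div (wt1 lam) (wt lam) eta _ _ D1 D0 (Rgt_not_eq _ _ W)).
  assert (D4 := is_derive_minus (fun z => tri a / jac lam z a) (fun z => wt1 lam z / wt lam z) eta _ _ D2 D3).
  evar_last.
  - exact (is_derive_mult (fun z => Rpower (wt lam z) (- 2 * lam))
      (fun z => tri a / jac lam z a - wt1 lam z / wt lam z) eta _ _ DP D4 Rmult_comm).
  - unfold slope, energy. unfold plus, minus, opp, mult; simpl. unfold plus, opp, mult; simpl.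
    set (E := Rpower (wt lam eta) (- 2 * lam)) in *.
    set (E' := Rpower (wt lam eta) (2 * lam)) in *.
    assert (HE : 0 < E) by apply Rpower_pos.
    replace E' with (/ E) by (apply Rmult_eq_reg_l with E; [rewrite P; field |]; lra).
    field. repeat split; lra.
Qed.

(** The weight in front of the square is the label derivative of [flow]. Expanding the square gives
    members of [kern] with [j] equal to 2, 1 and 0, whose integrals are [wt2], [wt1] and [wt]. *)
Lemma energy_RInt (lam eta : R) : Rabs (lam * eta) < 1 ->
  is_RInt (fun a => Rpower (jac lam eta a) (- / lam) / wt lam eta * slope lam eta a ^ 2) 0 1
    (energy lam eta).
Proof.
  intros H. assert (W := wt_pos lam eta H).
  set (q := - / lam). set (E := Rpower (wt lam eta) (- 2 * lam)). set (c := wt1 lam eta / wt lam eta).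
  assert (C : forall p j, is_RInt (kern lam p j eta) 0 1 (kint lam p j eta 1)).
  { intros p j. apply (RInt_correct (V := R_CompleteNormedModule)). now apply kern_ex_RInt. }
  apply is_RInt_ext with (fun a => E ^ 2 / wt lam eta *
    (kern lam (q - 2) 2 eta a + (- 2 * c * kern lam (q - 1) 1 eta a + c ^ 2 * kern lam q 0 eta a))).
  - intros a _. unfold kern. assert (J := jac_pos lam eta a H).
    replace (q - 2) with (q - 1 - 1) by ring. rewrite !Rpower_pred by trivial.
    unfold slope. fold E c q.
    match goal with |- @eq _ ?x ?y => change (@eq R x y) end.
    simpl. field. split; lra.
  - evar_last.
    + apply (is_RInt_scal (V := R_NormedModule)).
      apply (is_RInt_plus (V := R_NormedModule)); [apply C |].
      apply (is_RInt_plus (V := R_NormedModule)); apply (is_RInt_scal (V := R_NormedModule)); apply C.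
    + unfold scal, plus; simpl; unfold mult; simpl.
      unfold energy. fold E. fold q. change (kint lam q 0 eta 1) with (wt lam eta).
      change (kint lam (q - 1) 1 eta 1) with (wt1 lam eta).
      change (kint lam (q - 2) 2 eta 1) with (wt2 lam eta). unfold c.
      field. lra.
Qed.

(** * The flow as an increasing bijection of the line and its inverse *)

Lemma flow_lt (lam eta a b : R) : Rabs (lam * eta) < 1 -> a < b -> flow lam eta a < flow lam eta b.
Proof.
  intros H Hab. unfold flow. assert (W := wt_pos lam eta H).
  apply Rmult_lt_compat_r; [now apply Rinv_0_lt_compat |].
  unfold kint. rewrite <- (RInt_Chasles (V := R_CompleteNormedModule) _ 0 a b) by now apply kern_ex_RInt.
  assert (0 < RInt (kern lam (- / lam) 0 eta) a b).
  { apply RInt_gt_0; trivial; intros; [apply kern_0_pos | now apply kern_continuous]. }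
  unfold plus; simpl. lra.
Qed.

Lemma flow_inj (lam eta a b : R) : Rabs (lam * eta) < 1 -> flow lam eta a = flow lam eta b -> a = b.
Proof.
  intros H E. destruct (Rtotal_order a b) as [L | [L | L]]; trivial;
  apply (flow_lt lam eta _ _ H) in L; lra.
Qed.

Lemma flow_add1 (lam eta a : R) : Rabs (lam * eta) < 1 -> flow lam eta (a + 1) = flow lam eta a + 1.
Proof.
  intros H. unfold flow. assert (W := wt_pos lam eta H). rewrite kint_add1 by trivial.
  unfold wt in *. field. lra.
Qed.

(** Integers are stationary under the flow: they bracket each point in [flow_surj] and keep the
    limits 0 and 1 in the change of variables for the energy. *)
Lemma flow_IZR (lam eta : R) (k : Z) : Rabs (lam * eta) < 1 -> flow lam eta (IZR k) = IZR k.
Proof.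
  intros H. induction k as [| k IH | k IH] using Z.peano_ind.
  - unfold flow. rewrite kint_0. unfold Rdiv. ring.
  - rewrite succ_IZR, flow_add1, IH by trivial. reflexivity.
  - assert (E := flow_add1 lam eta (IZR (Z.pred k)) H).
    rewrite <- (Z.succ_pred k), succ_IZR in IH at 1. rewrite IH in E.
    rewrite <- (Z.succ_pred k), succ_IZR in E at 1. lra.
Qed.

Lemma vel_add1 (lam eta a : R) : Rabs (lam * eta) < 1 -> vel lam eta (a + 1) = vel lam eta a.
Proof.
  intros H. unfold vel. assert (W := wt_pos lam eta H). rewrite !kint_add1 by trivial.
  unfold wt1, wt in *. field. lra.
Qed.

Lemma flow_continuity (lam eta : R) : Rabs (lam * eta) < 1 -> continuity (flow lam eta).
Proof.
  intros H a. apply continuity_pt_filterlim, (ex_derive_continuous (flow lam eta)).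
  eexists. now apply flow_derive_a.
Qed.

Lemma flow_surj (lam eta x : R) : Rabs (lam * eta) < 1 -> exists a, flow lam eta a = x.
Proof.
  intros H. destruct (base_Int_part x) as [B1 B2].
  assert (E0 := flow_IZR lam eta (Int_part x) H).
  assert (E1 := flow_add1 lam eta (IZR (Int_part x)) H).
  destruct (IVT_gen (flow lam eta) (IZR (Int_part x)) (IZR (Int_part x) + 1) x) as [a [_ Ha]].
  - now apply flow_continuity.
  - rewrite E1, E0, Rmin_left, Rmax_right; lra.
  - now exists a.
Qed.

Definition label (lam eta x : R) : R := epsilon (inhabits 0) (fun a => flow lam eta a = x).

Lemma flow_label (lam eta x : R) : Rabs (lam * eta) < 1 -> flow lam eta (label lam eta x) = x.
Proof. intros H. unfold label. apply epsilon_spec. now apply flow_surj. Qed.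

Lemma label_flow (lam eta a : R) : Rabs (lam * eta) < 1 -> label lam eta (flow lam eta a) = a.
Proof. intros H. apply flow_inj with lam eta; trivial. now apply flow_label. Qed.

Lemma label_add1 (lam eta x : R) : Rabs (lam * eta) < 1 -> label lam eta (x + 1) = label lam eta x + 1.
Proof.
  intros H. apply flow_inj with lam eta; trivial.
  now rewrite flow_add1, !flow_label.
Qed.

Lemma flow_cont2 (lam eta a : R) : Rabs (lam * eta) < 1 -> continuity_2d_pt (flow lam) eta a.
Proof.
  intros H. unfold flow. apply continuity_2d_pt_mult; [now apply kint_cont2 |].
  apply continuity_2d_pt_inv.
  - apply (continuity_1d_2d_pt_comp (wt lam) (fun u _ => u)); [| apply continuity_2d_pt_id1].
    apply continuity_pt_filterlim.
    apply (continuity_2d_pt_fst (kint lam (- / lam) 0)). now apply kint_cont2.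
  - apply Rgt_not_eq. now apply wt_pos.
Qed.

(** Monotonicity replaces an implicit function theorem: the images of [a - eps] and [a + eps]
    straddle [x], and still straddle [y] after a small change of [eta], which traps the new label
    between them. *)
Lemma label_cont2 (lam eta x : R) : Rabs (lam * eta) < 1 -> continuity_2d_pt (label lam) eta x.
Proof.
  intros H eps. assert (He := cond_pos eps). set (a := label lam eta x).
  assert (Ea : flow lam eta a = x) by now apply flow_label.
  assert (L1 := flow_lt lam eta (a - eps) a H ltac:(lra)).
  assert (L2 := flow_lt lam eta a (a + eps) H ltac:(lra)).
  (* Half of the gap absorbs the motion of the two images with [z], the other half the motion of
     [y]. *)
  set (d := Rmin (x - flow lam eta (a - eps)) (flow lam eta (a + eps) - x) / 2).
  assert (Hd : 0 < d) by (unfold d, Rmin; destruct Rle_dec; lra).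
  destruct (locally_small lam eta H) as [d1 Hd1].
  destruct (flow_cont2 lam eta (a - eps) H (mkposreal d Hd)) as [d2 Hd2].
  destruct (flow_cont2 lam eta (a + eps) H (mkposreal d Hd)) as [d3 Hd3].
  assert (Hm : 0 < Rmin (Rmin d d1) (Rmin d2 d3)).
  { apply Rmin_pos; apply Rmin_pos; trivial; apply cond_pos. }
  exists (mkposreal _ Hm). simpl. intros z y Hz Hy.
  assert (M1 := Rmin_l (Rmin d d1) (Rmin d2 d3)). assert (M2 := Rmin_r (Rmin d d1) (Rmin d2 d3)).
  assert (M3 := Rmin_l d d1). assert (M4 := Rmin_r d d1).
  assert (M5 := Rmin_l d2 d3). assert (M6 := Rmin_r d2 d3).
  assert (Hsz : Rabs (lam * z) < 1).
  { apply Hd1. unfold ball; simpl; unfold AbsRing_ball, abs, minus, plus, opp; simpl. fold (z - eta). lra. }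
  assert (F2 := Hd2 z (a - eps) ltac:(lra)). rewrite Rminus_diag, Rabs_R0 in F2.
  assert (F3 := Hd3 z (a + eps) ltac:(lra)). rewrite Rminus_diag, Rabs_R0 in F3.
  specialize (F2 (cond_pos d2)). specialize (F3 (cond_pos d3)). simpl in F2, F3.
  assert (Hy' : Rabs (y - x) < d) by lra.
  assert (D1 : 2 * d <= x - flow lam eta (a - eps)) by (unfold d, Rmin; destruct Rle_dec; lra).
  assert (D2 : 2 * d <= flow lam eta (a + eps) - x) by (unfold d, Rmin; destruct Rle_dec; lra).
  apply Rabs_lt_between in F2. apply Rabs_lt_between in F3. apply Rabs_lt_between in Hy'.
  assert (Eb := flow_label lam z y Hsz). set (b := label lam z y) in *.
  apply Rabs_lt_between. fold a. split.
  - destruct (Rle_lt_dec b (a - eps)) as [Hb | Hb]; [| lra].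
    destruct (Rle_lt_or_eq_dec _ _ Hb) as [Hb' | Hb'].
    + apply (flow_lt lam z) in Hb'; trivial. lra.
    + rewrite Hb' in Eb. lra.
  - destruct (Rle_lt_dec (a + eps) b) as [Hb | Hb]; [| lra].
    destruct (Rle_lt_or_eq_dec _ _ Hb) as [Hb' | Hb'].
    + apply (flow_lt lam z) in Hb'; trivial. lra.
    + rewrite <- Hb' in Eb. lra.
Qed.

(** The difference quotient of [g] is the reciprocal of that of [f] along k = g (y + h) - g y. This
    k is nonzero because [f] recovers y + h from g (y + h), and it tends to 0 by continuity of [g].
    It serves both for [label] and for the time change. *)
Lemma derivable_pt_lim_inverse (f g : R -> R) (y l : R) :
  continuous g y -> locally y (fun z => f (g z) = z) ->
  derivable_pt_lim f (g y) l -> l <> 0 -> derivable_pt_lim g y (/ l).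
Proof.
  intros Hg [d1 Hd1] Hf Hl eps Heps.
  assert (E0 : f (g y) = y) by (apply Hd1, ball_center).
  assert (Hinv : continuity_pt Rinv l).
  { apply continuity_pt_inv; [apply derivable_continuous_pt, derivable_pt_id | trivial]. }
  destruct (Hinv eps Heps) as [d2 [Hd2 Hd2']].
  destruct (Hf d2 Hd2) as [d3 Hd3].
  apply continuity_pt_filterlim in Hg.
  destruct (Hg d3 (cond_pos d3)) as [d4 [Hd4 Hd4']].
  assert (Hm : 0 < Rmin d1 d4) by (apply Rmin_pos; trivial; apply cond_pos).
  exists (mkposreal _ Hm). simpl. intros h Hh0 Hh.
  assert (M1 := Rmin_l d1 d4). assert (M2 := Rmin_r d1 d4).
  assert (E1 : f (g (y + h)) = y + h).
  { apply Hd1. unfold ball; simpl; unfold AbsRing_ball, abs, minus, plus, opp; simpl.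
    replace (y + h + - y) with h by ring. lra. }
  set (k := g (y + h) - g y).
  assert (Ek : g (y + h) = g y + k) by (unfold k; ring).
  assert (Hk0 : k <> 0).
  { intros K. rewrite K, Rplus_0_r in Ek. rewrite Ek in E1. lra. }
  assert (Hk : Rabs k < d3).
  { apply (Hd4' (y + h)). split; [split; [exact I | lra] |]. simpl. unfold R_dist.
    replace (y + h - y) with h by ring. lra. }
  specialize (Hd3 k Hk0 Hk). rewrite <- Ek, E1, E0 in Hd3.
  replace (y + h - y) with h in Hd3 by ring.
  fold k. replace (k / h) with (/ (h / k)) by (field; auto).
  (* Limits are taken over punctured neighbourhoods, so the case where the quotient equals its limit
     stands apart. *)
  destruct (Req_dec (h / k) l) as [-> | Hne].
  - rewrite Rminus_diag, Rabs_R0. trivial.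
  - apply (Hd2' (h / k)). split; [split; [exact I | auto] | exact Hd3].
Qed.

Lemma label_derive (lam eta x : R) : Rabs (lam * eta) < 1 ->
  is_derive (label lam eta) x
    (wt lam eta / Rpower (jac lam eta (label lam eta x)) (- / lam)).
Proof.
  intros H. assert (W := wt_pos lam eta H).
  assert (P := Rpower_pos (jac lam eta (label lam eta x)) (- / lam)).
  apply is_derive_Reals.
  replace (wt lam eta / _) with (/ (Rpower (jac lam eta (label lam eta x)) (- / lam) / wt lam eta))
    by (field; lra).
  apply derivable_pt_lim_inverse with (flow lam eta).
  - apply continuity_2d_pt_snd. now apply label_cont2.
  - apply filter_forall. intros z. now apply flow_label.
  - apply is_derive_Reals. now apply flow_derive_a.
  - apply Rgt_not_eq, Rdiv_lt_0_compat; trivial.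
Qed.

(** * From the parameter eta to physical time *)

(** [H] inverts T(h) = int_0^h g, and [ts] is the supremum of T over [0, es), finite because of [B].
    Taking [g] on both sides of 0 makes T differentiable at 0 in the two-sided sense. The last
    conclusion transfers every statement about eta near [es] to times near [ts]. *)
Lemma time_change (g : R -> R) (es B : R) : 0 < es ->
  (forall h, - es < h < es -> continuous g h /\ 0 < g h) ->
  (forall h, 0 <= h < es -> RInt g 0 h <= B) ->
  exists (ts : R) (H : R -> R),
    0 < ts /\ H 0 = 0 /\
    (forall t, 0 <= t < ts -> 0 <= H t < es) /\
    (forall t, 0 < t < ts -> derivable_pt_lim H t (/ g (H t))) /\
    (forall t eps, 0 <= t < ts -> 0 < eps -> exists d, 0 < d /\
       forall s, 0 <= s < ts -> Rabs (s - t) < d -> Rabs (H s - H t) < eps) /\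
    (forall h, h < es -> exists d, 0 < d /\ forall t, 0 <= t -> ts - d < t < ts -> h < H t).
Proof.
  intros Hes Hg HB. set (T := fun h => RInt g 0 h).
  assert (Hex : forall a b, - es < a < es -> - es < b < es -> ex_RInt g a b).
  { intros a b Ha Hb. apply (ex_RInt_continuous (V := R_CompleteNormedModule)).
    intros z Hz. apply Hg. revert Hz. unfold Rmin, Rmax. destruct Rle_dec; lra. }
  assert (HT : forall h, - es < h < es -> is_derive T h (g h)).
  { intros h Hh. apply (is_derive_RInt g T 0); [| now apply Hg].
    assert (Hl : locally h (fun b => - es < b < es)).
    { apply (locally_interval _ h (- es) es); simpl; try lra. intros; lra. }
    revert Hl. apply filter_imp. intros b Hb.
    apply (RInt_correct (V := R_CompleteNormedModule)). apply Hex; lra. }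
  assert (Hlt : forall a b, 0 <= a -> a < b -> b < es -> T a < T b).
  { intros a b Ha Hab Hb. unfold T.
    rewrite <- (RInt_Chasles (V := R_CompleteNormedModule) g 0 a b) by (apply Hex; lra).
    assert (0 < RInt g a b) by (apply RInt_gt_0; trivial; intros; apply Hg; lra).
    unfold plus; simpl. lra. }
  assert (HT0 : T 0 = 0) by apply (RInt_point (V := R_CompleteNormedModule)).
  destruct (completeness (fun y => exists h, 0 <= h < es /\ y = T h)) as [ts [Hub Hlub]].
  { exists B. intros y [h [Hh ->]]. now apply HB. }
  { exists (T 0), 0. split; [lra | trivial]. }
  assert (Hts : forall h, 0 <= h < es -> T h < ts).
  { intros h Hh. apply Rlt_le_trans with (T ((h + es) / 2)); [apply Hlt; lra |].
    apply Hub. exists ((h + es) / 2). split; [lra | trivial]. }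
  assert (Hsurj : forall t, 0 <= t < ts -> exists h, 0 <= h < es /\ T h = t).
  { intros t Ht. destruct (Req_dec t 0) as [-> | Ht0].
    { exists 0. split; [lra | trivial]. }
    assert (Hb : exists b, 0 <= b < es /\ t < T b).
    { apply Classical_Prop.NNPP. intros N. apply (Rlt_irrefl ts), Rle_lt_trans with t; [| lra].
      apply Hlub. intros y [h [Hh ->]]. apply Rnot_lt_le. intros K. apply N. now exists h. }
    destruct Hb as [b [Hb Htb]].
    assert (Hb0 : 0 < b) by (destruct (Req_dec b 0); [subst; lra | lra]).
    destruct (Ranalysis5.IVT_interv (fun h => T h - t) 0 b) as [h [Hh Eh]]; try lra.
    - intros a Ha. apply continuity_pt_minus; [| apply continuity_pt_const; intros ? ?; trivial].
      apply continuity_pt_filterlim, (ex_derive_continuous T). eexists. apply HT. lra.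
    - exists h. lra. }
  set (H := fun t => epsilon (inhabits 0) (fun h => 0 <= h < es /\ T h = t)).
  assert (HH : forall t, 0 <= t < ts -> 0 <= H t < es /\ T (H t) = t).
  { intros t Ht. unfold H. apply epsilon_spec. now apply Hsurj. }
  assert (Hinj : forall a b, 0 <= a < es -> 0 <= b < es -> T a < T b -> a < b).
  { intros a b Ha Hb Hab. apply Rnot_le_lt. intros [K | K].
    - apply Hlt in K; lra.
    - subst. lra. }
  assert (Hts0 : 0 < ts) by (rewrite <- HT0; apply Hts; lra).
  assert (Hc : forall t eps, 0 <= t < ts -> 0 < eps -> exists d, 0 < d /\
       forall s, 0 <= s < ts -> Rabs (s - t) < d -> Rabs (H s - H t) < eps).
  { intros t eps Ht Heps. destruct (HH t Ht) as [Hh Eh]. set (h := H t) in *.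
    (* The midpoint with [es] keeps [h2] inside the domain of T. Below, [h - eps] may leave that
       domain, but then the lower bound is automatic since [H] is nonnegative. *)
    set (h2 := Rmin (h + eps) ((h + es) / 2)).
    assert (Hh2 : h < h2 < es /\ h2 <= h + eps) by (unfold h2, Rmin; destruct Rle_dec; lra).
    assert (T2 := Hlt h h2 ltac:(lra) ltac:(lra) ltac:(lra)).
    destruct (Rlt_le_dec (h - eps) 0) as [Hlow | Hlow].
    - exists (T h2 - t). split; [lra |]. intros s Hs Hst. destruct (HH s Hs) as [Hk Ek].
      apply Rabs_lt_between in Hst. assert (H s < h2) by (apply Hinj; lra).
      apply Rabs_lt_between. lra.
    - assert (T1 := Hlt (h - eps) h ltac:(lra) ltac:(lra) ltac:(lra)).
      exists (Rmin (T h2 - t) (t - T (h - eps))). split; [apply Rmin_pos; lra |].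
      intros s Hs Hst. destruct (HH s Hs) as [Hk Ek].
      assert (M1 := Rmin_l (T h2 - t) (t - T (h - eps))).
      assert (M2 := Rmin_r (T h2 - t) (t - T (h - eps))).
      apply Rabs_lt_between in Hst.
      assert (H s < h2) by (apply Hinj; lra).
      assert (h - eps < H s) by (apply Hinj; lra).
      apply Rabs_lt_between. lra. }
  exists ts, H. repeat split; trivial.
  - destruct (HH 0) as [H1 H2]; [lra |].
    apply Rle_antisym; [| lra]. apply Rnot_lt_le. intros K. apply Hlt in K; lra.
  - now apply HH.
  - now apply HH.
  - intros t Ht. destruct (HH t) as [Hh Eh]; [lra |].
    apply derivable_pt_lim_inverse with T.
    + apply continuity_pt_filterlim. intros eps Heps.
      destruct (Hc t eps) as [d [Hd Hd']]; [lra | trivial |].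
      exists (Rmin d (Rmin t (ts - t))). split; [apply Rmin_pos; trivial; apply Rmin_pos; lra |].
      intros s [_ Hs]. simpl in *. unfold R_dist in *.
      assert (M1 := Rmin_l d (Rmin t (ts - t))). assert (M2 := Rmin_r d (Rmin t (ts - t))).
      assert (M3 := Rmin_l t (ts - t)). assert (M4 := Rmin_r t (ts - t)).
      apply Hd'; [| lra]. apply Rabs_lt_between in Hs. lra.
    + apply (locally_interval _ t 0 ts); simpl; try lra. intros s Hs1 Hs2. apply HH. lra.
    + apply is_derive_Reals, HT. lra.
    + apply Rgt_not_eq, Hg. lra.
  - intros h Hh. destruct (Rlt_le_dec h 0) as [Hn | Hn].
    + exists ts. split; trivial. intros t Ht0 Ht. destruct (HH t); lra.
    + assert (Th := Hts h ltac:(lra)). exists (ts - T h). split; [lra |].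
      intros t Ht0 Ht. destruct (HH t); [lra |]. apply Hinj; lra.
Qed.

(** * Integrals of the triangle wave and the values at eta = 0 *)

(** Folds a period onto [0, 1/2], where [tri] is affine and antiderivatives are explicit. *)
Lemma RInt_reflect (f : R -> R) : (forall x, continuous f x) -> (forall x, f (1 - x) = f x) ->
  RInt f 0 1 = 2 * RInt f 0 (1 / 2).
Proof.
  intros Hc Hf.
  assert (Hex : forall a b, ex_RInt f a b).
  { intros a b. apply (ex_RInt_continuous (V := R_CompleteNormedModule)). intros; apply Hc. }
  rewrite <- (RInt_Chasles (V := R_CompleteNormedModule) f 0 (1 / 2) 1) by apply Hex.
  assert (E := RInt_comp_lin f (- 1) 1 0 (1 / 2) (Hex _ _)).
  replace (- 1 * 0 + 1) with 1 in E by ring. replace (- 1 * (1 / 2) + 1) with (1 / 2) in E by field.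
  rewrite <- (opp_RInt_swap (V := R_CompleteNormedModule) f 1 (1 / 2)) by apply Hex.
  rewrite <- E, (RInt_ext (fun y => scal (- 1) (f (- 1 * y + 1))) (fun y => scal (- 1) (f y))).
  - rewrite (RInt_scal (V := R_CompleteNormedModule)) by apply Hex.
    unfold plus, opp, scal; simpl; unfold mult; simpl. ring.
  - intros y _. replace (-1 * y + 1) with (1 - y) by ring. now rewrite Hf.
Qed.

Lemma RInt_tri : RInt tri 0 1 = 0.
Proof.
  rewrite RInt_reflect; [| apply tri_continuous | apply tri_refl].
  assert (E : is_RInt tri 0 (1 / 2) (minus (1 / 2 - 2 * (1 / 2) ^ 2) (0 - 2 * 0 ^ 2))).
  { apply (is_RInt_derive (fun x => x - 2 * x ^ 2)).
    - intros x Hx. rewrite Rmin_left, Rmax_right in Hx by lra. rewrite tri_left by lra.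
      auto_derive; trivial. ring.
    - intros x _. apply tri_continuous. }
  rewrite (is_RInt_unique _ _ _ _ E). unfold minus, plus, opp; simpl. field.
Qed.

Lemma Rpower_base1 (p : R) : Rpower 1 p = 1.
Proof. unfold Rpower. rewrite ln_1, Rmult_0_r. apply exp_0. Qed.

Lemma kint_eta0 (lam p : R) (j : nat) (a : R) :
  kint lam p j 0 a = RInt (fun y => tri y ^ j) 0 a.
Proof.
  apply RInt_ext. intros y _. unfold kern, jac.
  rewrite Rmult_0_r, Rmult_0_l, Rminus_0_r, Rpower_base1. apply Rmult_1_r.
Qed.

Lemma kint_00 (lam p a : R) : kint lam p 0 0 a = a.
Proof.
  rewrite kint_eta0. simpl. rewrite RInt_const. unfold scal; simpl; unfold mult; simpl. ring.
Qed.

Lemma kint_10 (lam p a : R) : kint lam p 1 0 a = RInt tri 0 a.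
Proof. rewrite kint_eta0. apply RInt_ext. intros y _. apply pow_1. Qed.

(** The initial datum u0; starting the primitive at 0 makes it odd about 1/2, hence of mean zero
    over a period. *)
Definition tri_prim (x : R) : R := RInt tri 0 x.

Lemma wt_0 (lam : R) : wt lam 0 = 1.
Proof. apply kint_00. Qed.

Lemma flow_0 (lam a : R) : flow lam 0 a = a.
Proof. unfold flow. rewrite wt_0, kint_00. field. Qed.

Lemma vel_0 (lam a : R) : vel lam 0 a = tri_prim a.
Proof.
  unfold vel, wt1. rewrite wt_0, Rpower_base1, kint_00, !kint_10, RInt_tri.
  unfold tri_prim. field.
Qed.

Lemma label_0 (lam x : R) : label lam 0 x = x.
Proof.
  rewrite <- (flow_0 lam (label lam 0 x)). apply flow_label.
  rewrite Rmult_0_r, Rabs_R0. lra.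
Qed.

(** * Assembling the solution in the original variables *)

Lemma continuity_2d_pt_1 (f : R -> R) (x y : R) : continuous f x ->
  continuity_2d_pt (fun u _ => f u) x y.
Proof.
  intros H. apply (continuity_1d_2d_pt_comp f (fun u _ => u)); [| apply continuity_2d_pt_id1].
  now apply continuity_pt_filterlim.
Qed.

Lemma wt_continuous (lam eta : R) : Rabs (lam * eta) < 1 -> continuous (wt lam) eta.
Proof. intros H. apply (continuity_2d_pt_fst (kint lam (- / lam) 0)). now apply kint_cont2. Qed.

Lemma wt1_continuous (lam eta : R) : Rabs (lam * eta) < 1 -> continuous (wt1 lam) eta.
Proof. intros H. apply (continuity_2d_pt_fst (kint lam (- / lam - 1) 1)). now apply kint_cont2. Qed.

Lemma wt_Rpower_continuous (lam p eta : R) : lam <> 0 -> Rabs (lam * eta) < 1 ->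
  continuous (fun z => Rpower (wt lam z) p) eta.
Proof.
  intros Hl H. apply (ex_derive_continuous (fun z => Rpower (wt lam z) p)).
  eexists. now apply wt_Rpower_derive.
Qed.

Lemma vel_cont2 (lam eta a : R) : lam <> 0 -> Rabs (lam * eta) < 1 ->
  continuity_2d_pt (vel lam) eta a.
Proof.
  intros Hl H. assert (W := wt_pos lam eta H).
  assert (Cw : continuity_2d_pt (fun u _ => wt lam u) eta a)
    by now apply continuity_2d_pt_1, wt_continuous.
  unfold vel, Rdiv. apply continuity_2d_pt_mult.
  - now apply continuity_2d_pt_1, wt_Rpower_continuous.
  - apply continuity_2d_pt_minus; apply continuity_2d_pt_mult.
    + now apply kint_cont2.
    + apply continuity_2d_pt_inv; trivial. lra.
    + apply continuity_2d_pt_mult; [now apply kint_cont2 |].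
      now apply continuity_2d_pt_1, wt1_continuous.
    + apply continuity_2d_pt_inv; [| apply pow_nonzero; lra].
      simpl. repeat apply continuity_2d_pt_mult; trivial. apply continuity_2d_pt_const.
Qed.

Lemma slope_cont2 (lam eta a : R) : lam <> 0 -> Rabs (lam * eta) < 1 ->
  continuity_2d_pt (slope lam) eta a.
Proof.
  intros Hl H. assert (W := wt_pos lam eta H). assert (J := jac_pos lam eta a H).
  assert (Ht : continuity_2d_pt (fun _ y => tri y) eta a).
  { apply (continuity_1d_2d_pt_comp tri (fun _ y => y)).
    apply tri_continuity. apply continuity_2d_pt_id2. }
  unfold slope, Rdiv. apply continuity_2d_pt_mult.
  - now apply continuity_2d_pt_1, wt_Rpower_continuous.
  - apply continuity_2d_pt_minus; apply continuity_2d_pt_mult; trivial.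
    + apply continuity_2d_pt_inv; [| lra]. unfold jac.
      apply continuity_2d_pt_minus; [apply continuity_2d_pt_const |].
      apply continuity_2d_pt_mult; trivial.
      apply continuity_2d_pt_mult; [apply continuity_2d_pt_const | apply continuity_2d_pt_id1].
    + now apply continuity_2d_pt_1, wt1_continuous.
    + apply continuity_2d_pt_inv; [now apply continuity_2d_pt_1, wt_continuous | lra].
Qed.

Lemma cont2_on_label (f : R -> R -> R) (lam ts : R) (H : R -> R) :
  (forall t, 0 <= t < ts -> Rabs (lam * H t) < 1) ->
  (forall t eps, 0 <= t < ts -> 0 < eps -> exists d, 0 < d /\
     forall s, 0 <= s < ts -> Rabs (s - t) < d -> Rabs (H s - H t) < eps) ->
  (forall eta a, Rabs (lam * eta) < 1 -> continuity_2d_pt f eta a) ->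
  cont2_on (fun x t => f (H t) (label lam (H t) x)) ts.
Proof.
  intros HH Hc Hf x t Ht eps Heps.
  destruct (Hf _ (label lam (H t) x) (HH t Ht) (mkposreal eps Heps)) as [d1 Hd1].
  destruct (label_cont2 lam (H t) x (HH t Ht) d1) as [d2 Hd2].
  destruct (Hc t (Rmin d1 d2) Ht) as [d3 [Hd3 Hd3']]; [apply Rmin_pos; apply cond_pos |].
  assert (M1 := Rmin_l d1 d2). assert (M2 := Rmin_r d1 d2).
  exists (Rmin d2 d3). split; [apply Rmin_pos; trivial; apply cond_pos |].
  intros y s Hs Hy Hst. assert (M3 := Rmin_l d2 d3). assert (M4 := Rmin_r d2 d3).
  assert (K := Hd3' s Hs ltac:(lra)). apply Hd1; [lra |]. apply Hd2; lra.
Qed.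

(** Substituting x = gamma(a) pulls the integral back to labels, where it is [energy_RInt];
    [flow_IZR] keeps the interval [0, 1]. *)
Lemma energy_of_slope (lam eta : R) : lam <> 0 -> Rabs (lam * eta) < 1 ->
  is_RInt (fun x => slope lam eta (label lam eta x) ^ 2) 0 1 (energy lam eta).
Proof.
  intros Hl H. assert (W := wt_pos lam eta H).
  set (f := fun x => slope lam eta (label lam eta x) ^ 2).
  assert (Hs : forall a, continuous (slope lam eta) a).
  { intros a. now apply continuity_2d_pt_snd, slope_cont2. }
  assert (Hf : forall x, continuous f x).
  { intros x. apply (continuous_comp (fun x => slope lam eta (label lam eta x)) (fun y => y ^ 2)).
    - apply (continuous_comp (label lam eta) (slope lam eta)); trivial.
      now apply continuity_2d_pt_snd, label_cont2.
    - apply (ex_derive_continuous (fun y => y ^ 2)). auto_derive; trivial. }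
  assert (E : RInt (fun y => scal (Rpower (jac lam eta y) (- / lam) / wt lam eta) (f (flow lam eta y))) 0 1
     = RInt f (flow lam eta 0) (flow lam eta 1)).
  { apply (RInt_comp f (flow lam eta) (fun y => Rpower (jac lam eta y) (- / lam) / wt lam eta));
      [intros; apply Hf |]. intros a _. split; [now apply flow_derive_a |].
    assert (K := kern_continuous lam (- / lam) 0 eta a H).
    apply continuous_ext with (fun y => kern lam (- / lam) 0 eta y * / wt lam eta).
    { intros y. unfold kern. simpl. rewrite Rmult_1_l. reflexivity. }
    apply (continuous_mult (K := R_AbsRing)); [exact K | apply continuous_const]. }
  rewrite (flow_IZR lam eta 0 H), (flow_IZR lam eta 1 H) in E.
  assert (E2 := is_RInt_unique (V := R_CompleteNormedModule) _ _ _ _ (energy_RInt lam eta H)).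
  rewrite <- E2.
  rewrite (RInt_ext _ (fun y => scal (Rpower (jac lam eta y) (- / lam) / wt lam eta) (f (flow lam eta y)))).
  - rewrite E. apply (RInt_correct (V := R_CompleteNormedModule)).
    apply (ex_RInt_continuous (V := R_CompleteNormedModule)). intros; apply Hf.
  - intros a _. unfold f. rewrite label_flow by trivial. reflexivity.
Qed.

Lemma Rabs_lam_mult (lam h : R) : lam <> 0 -> - / Rabs lam < h < / Rabs lam -> Rabs (lam * h) < 1.
Proof.
  intros Hl Hh. assert (P := Rabs_pos_lt lam Hl). rewrite Rabs_mult.
  rewrite <- (Rinv_r (Rabs lam)) by lra. apply Rmult_lt_compat_l; trivial.
  apply Rabs_lt_between. lra.
Qed.

(** The bound [B] on the integral of dt/d eta = F^(2 lam) is the only input that depends on the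
    range of lam. [H] is handed out as well, so that blow-up can be studied on [slope] near eta =
    1/|lam|. *)
Lemma solution_exists (lam B : R) : lam <> 0 ->
  (forall h, 0 <= h < / Rabs lam -> RInt (fun z => Rpower (wt lam z) (2 * lam)) 0 h <= B) ->
  exists (ts : R) (u ux gam : R -> R -> R) (H : R -> R),
    0 < ts /\ is_solution lam tri_prim ts u ux gam /\
    (forall t, 0 <= t < ts -> 0 <= H t < / Rabs lam) /\
    (forall a t, 0 <= t < ts -> ux (gam a t) t = slope lam (H t) a) /\
    (forall h, h < / Rabs lam -> exists d, 0 < d /\
       forall t, 0 <= t -> ts - d < t < ts -> h < H t).
Proof.
  intros Hl HB. assert (P := Rinv_0_lt_compat _ (Rabs_pos_lt lam Hl)).
  destruct (time_change (fun z => Rpower (wt lam z) (2 * lam)) (/ Rabs lam) B P) as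
    (ts & H & Hts & H0 & HH & HD & HC & HE); trivial.
  { intros h Hh. split; [| apply Rpower_pos].
    apply wt_Rpower_continuous; trivial. now apply Rabs_lam_mult. }
  assert (HS : forall t, 0 <= t < ts -> Rabs (lam * H t) < 1).
  { intros t Ht. apply Rabs_lam_mult; trivial. assert (K := HH t Ht). lra. }
  assert (EX : forall a t, 0 <= t < ts ->
    slope lam (H t) (label lam (H t) (flow lam (H t) a)) = slope lam (H t) a).
  { intros a t Ht. rewrite label_flow; auto. }
  exists ts, (fun x t => vel lam (H t) (label lam (H t) x)),
    (fun x t => slope lam (H t) (label lam (H t) x)), (fun a t => flow lam (H t) a), H.
  split; [trivial |]. split; [| now split; [| split]].
  split; [intros x; rewrite H0, label_0; apply vel_0 |].
  split; [intros t Ht x; rewrite label_add1, vel_add1; auto |].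
  split.
  { intros t Ht x. assert (S := HS t Ht). apply is_derive_Reals.
    set (e := H t) in *. assert (W := wt_pos lam e S).
    assert (PJ := Rpower_pos (jac lam e (label lam e x)) (- / lam)).
    evar_last.
    - apply (is_derive_comp (vel lam e) (label lam e)); [now apply vel_derive_a | now apply label_derive].
    - unfold scal; simpl; unfold mult; simpl. field. lra. }
  split; [apply cont2_on_label; auto; intros; now apply vel_cont2 |].
  split; [apply cont2_on_label; auto; intros; now apply slope_cont2 |].
  split; [intros a; rewrite H0; apply flow_0 |].
  assert (Hin : forall t, 0 < t < ts -> 0 <= t < ts) by (intros; lra).
  split.
  { intros a t Ht. rewrite label_flow by auto. apply is_derive_Reals. evar_last.
    - apply (is_derive_comp (fun z => flow lam z a) H); [apply flow_derive_eta; auto |].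
      apply is_derive_Reals. now apply HD.
    - unfold scal; simpl; unfold mult; simpl.
      field. apply Rgt_not_eq, Rpower_pos. }
  split.
  { intros a eps Heps.
    destruct (flow_cont2 lam (H 0) a (HS 0 ltac:(lra)) (mkposreal eps Heps)) as [d1 Hd1].
    destruct (HC 0 d1) as [d2 [Hd2 Hd2']]; [lra | apply cond_pos |].
    exists d2. split; trivial. intros s Hs Hsd.
    rewrite <- (flow_0 lam a) at 2. rewrite <- H0. apply Hd1.
    - apply Hd2'; trivial. rewrite Rminus_0_r, Rabs_pos_eq; lra.
    - rewrite Rminus_diag, Rabs_R0. apply cond_pos. }
  exists (fun t => energy lam (H t)). split.
  { intros t Ht. assert (E := energy_of_slope lam (H t) Hl (HS t Ht)).
    assert (pr := ex_RInt_Reals_0 _ _ _ (ex_intro _ _ E)). exists pr.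
    rewrite <- RInt_Reals. now apply is_RInt_unique. }
  intros a t Ht. rewrite EX by auto. apply is_derive_Reals.
  (* [label] undoes [flow] only for times in [0, ts), so the two functions are exchanged on a
     neighbourhood of [t]. *)
  apply (is_derive_ext_loc (fun s => slope lam (H s) a)).
  { apply (locally_interval _ t 0 ts); simpl; try lra.
    intros s Hs1 Hs2. symmetry. apply EX. split; [left |]; trivial. }
  evar_last.
  - apply (is_derive_comp (fun z => slope lam z a) H); [apply slope_derive_eta; auto |].
    apply is_derive_Reals. now apply HD.
  - unfold scal; simpl; unfold mult; simpl. field. apply Rgt_not_eq, Rpower_pos.
Qed.

(** * Exact integral identities for the triangle wave *)

Lemma kern_refl (lam p : R) (j : nat) (eta a : R) : kern lam p j eta (1 - a) = kern lam p j eta a.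
Proof. unfold kern, jac. now rewrite tri_refl. Qed.

Lemma kint_half (lam p : R) (j : nat) (eta : R) : Rabs (lam * eta) < 1 ->
  kint lam p j eta 1 = 2 * kint lam p j eta (1 / 2).
Proof.
  intros H. apply RInt_reflect.
  - intros x. now apply kern_continuous.
  - intros x. apply kern_refl.
Qed.

(** On [0, 1/2] the Jacobian grows affinely from 1 - s to 1 + s with slope 4 s, where s = lam eta,
    so J^(p - 1) is an exact derivative up to a constant; reflection doubles the result. *)
Lemma kint_FTC (lam p eta : R) : lam * eta <> 0 -> Rabs (lam * eta) < 1 ->
  2 * (lam * eta) * p * kint lam (p - 1) 0 eta 1
  = Rpower (1 + lam * eta) p - Rpower (1 - lam * eta) p.
Proof.
  intros H0 H. rewrite kint_half by trivial. set (s := lam * eta) in *.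
  apply Rabs_lt_between in H as H'.
  assert (E : is_RInt (fun a => 4 * s * p * kern lam (p - 1) 0 eta a) 0 (1 / 2)
    (minus (Rpower (1 - s * (1 - 4 * (1 / 2))) p) (Rpower (1 - s * (1 - 4 * 0)) p))).
  { apply (is_RInt_derive (fun a => Rpower (1 - s * (1 - 4 * a)) p)).
    - intros x Hx. rewrite Rmin_left, Rmax_right in Hx by lra.
      assert (J := jac_pos lam eta x H). unfold kern. rewrite Rpower_pred by trivial.
      unfold jac in *. fold s in J |- *. rewrite tri_left in J |- * by lra.
      unfold Rpower. auto_derive; [lra |]. unfold Rminus in *. field. lra.
    - intros x _. apply (continuous_mult (K := R_AbsRing) (fun _ => 4 * s * p)).
      apply continuous_const. now apply kern_continuous. }
  assert (E2 : is_RInt (fun a => 4 * s * p * kern lam (p - 1) 0 eta a) 0 (1 / 2)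
    (4 * s * p * kint lam (p - 1) 0 eta (1 / 2))).
  { apply (is_RInt_scal (V := R_NormedModule)).
    apply (RInt_correct (V := R_CompleteNormedModule)). now apply kern_ex_RInt. }
  apply (is_RInt_unique (V := R_CompleteNormedModule)) in E.
  apply (is_RInt_unique (V := R_CompleteNormedModule)) in E2. rewrite E in E2.
  unfold minus, plus, opp in E2; simpl in E2.
  replace (1 - s * (1 - 4 * (1 / 2))) with (1 + s) in E2 by field.
  replace (1 - s * (1 - 4 * 0)) with (1 - s) in E2 by ring. lra.
Qed.

(** Differentiate a J^p on [0, 1/2] and use 4 s a = J - (1 - s), with s = lam eta. The factor a
    removes the boundary term (1 - s)^p at 0, the one that is singular for negative p. *)
Lemma kint_by_parts (lam p eta : R) : Rabs (lam * eta) < 1 ->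
  (1 + p) * kint lam p 0 eta 1 - p * (1 - lam * eta) * kint lam (p - 1) 0 eta 1
  = Rpower (1 + lam * eta) p.
Proof.
  intros H. rewrite !kint_half by trivial. set (s := lam * eta) in *.
  apply Rabs_lt_between in H as H'.
  assert (E : is_RInt (fun a => (1 + p) * kern lam p 0 eta a
        + - (p * (1 - s)) * kern lam (p - 1) 0 eta a) 0 (1 / 2)
    (minus (1 / 2 * Rpower (1 - s * (1 - 4 * (1 / 2))) p) (0 * Rpower (1 - s * (1 - 4 * 0)) p))).
  { apply (is_RInt_derive (fun a => a * Rpower (1 - s * (1 - 4 * a)) p)).
    - intros x Hx. rewrite Rmin_left, Rmax_right in Hx by lra.
      assert (J := jac_pos lam eta x H). unfold kern. rewrite Rpower_pred by trivial.
      unfold jac in *. fold s in J |- *. rewrite tri_left in J |- * by lra.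
      unfold Rpower. auto_derive; [lra |]. unfold Rminus in *. simpl. field. lra.
    - intros x _. apply (continuous_plus (V := R_NormedModule));
        apply (continuous_mult (K := R_AbsRing)); try apply continuous_const;
        now apply kern_continuous. }
  assert (E2 : is_RInt (fun a => (1 + p) * kern lam p 0 eta a
        + - (p * (1 - s)) * kern lam (p - 1) 0 eta a) 0 (1 / 2)
    ((1 + p) * kint lam p 0 eta (1 / 2) + - (p * (1 - s)) * kint lam (p - 1) 0 eta (1 / 2))).
  { apply (is_RInt_plus (V := R_NormedModule)); apply (is_RInt_scal (V := R_NormedModule));
    apply (RInt_correct (V := R_CompleteNormedModule)); now apply kern_ex_RInt. }
  apply (is_RInt_unique (V := R_CompleteNormedModule)) in E.
  apply (is_RInt_unique (V := R_CompleteNormedModule)) in E2. rewrite E in E2.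
  unfold minus, plus, opp in E2; simpl in E2.
  replace (1 - s * (1 - 4 * (1 / 2))) with (1 + s) in E2 by field. lra.
Qed.

(** Since lam eta u0' = 1 - J, the factor u0' in F' trades for a difference of two pure powers of J,
    to which the preceding identities apply. *)
Lemma wt1_wt (lam eta : R) : Rabs (lam * eta) < 1 ->
  lam * eta * wt1 lam eta = kint lam (- / lam - 1) 0 eta 1 - wt lam eta.
Proof.
  intros H. set (q := - / lam).
  assert (C : forall p j, is_RInt (kern lam p j eta) 0 1 (kint lam p j eta 1)).
  { intros p j. apply (RInt_correct (V := R_CompleteNormedModule)). now apply kern_ex_RInt. }
  assert (E1 : is_RInt (fun a => lam * eta * kern lam (q - 1) 1 eta a) 0 1 (lam * eta * wt1 lam eta)).
  { apply (is_RInt_scal (V := R_NormedModule)). apply C. }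
  assert (E2 : is_RInt (fun a => lam * eta * kern lam (q - 1) 1 eta a) 0 1
     (kint lam (q - 1) 0 eta 1 - wt lam eta)).
  { apply is_RInt_ext with (fun a => minus (kern lam (q - 1) 0 eta a) (kern lam q 0 eta a)).
    - intros a _. assert (J := jac_pos lam eta a H). unfold kern.
      rewrite Rpower_pred by trivial. unfold minus, plus, opp; simpl.
      replace (lam * eta * (tri a * 1 * (Rpower (jac lam eta a) q / jac lam eta a)))
        with ((1 - jac lam eta a) * (Rpower (jac lam eta a) q / jac lam eta a))
        by (unfold jac at 1; ring).
      field. lra.
    - apply (is_RInt_minus (V := R_NormedModule)); apply C. }
  apply (is_RInt_unique (V := R_CompleteNormedModule)) in E1.
  apply (is_RInt_unique (V := R_CompleteNormedModule)) in E2. congruence.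
Qed.

(** * Elementary bounds on powers and on the approach to the endpoint *)

Lemma Rpower_le_neg (a b c : R) : 0 < a -> a <= b -> c <= 0 -> Rpower b c <= Rpower a c.
Proof.
  intros Ha Hab Hc. replace c with (- - c) by ring. rewrite !(Rpower_Ropp _ (- c)).
  apply Rinv_le_contravar; [apply Rpower_pos |]. apply Rle_Rpower_l; lra.
Qed.

Lemma Rpower_le_1_l (x c : R) : 0 < x <= 1 -> 0 <= c -> Rpower x c <= 1.
Proof. intros Hx Hc. rewrite <- (Rpower_base1 c). apply Rle_Rpower_l; lra. Qed.

Lemma Rpower_le_1_r (x c : R) : 1 <= x -> c <= 0 -> Rpower x c <= 1.
Proof. intros Hx Hc. rewrite <- (Rpower_base1 c). apply Rpower_le_neg; lra. Qed.

Lemma Rpower_diverges (e K : R) : 0 < e ->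
  exists d, 0 < d /\ forall x, 0 < x < d -> K < Rpower x (- e).
Proof.
  intros He. set (K' := Rmax K 1). assert (HK : 0 < K') by (unfold K'; assert (H := Rmax_r K 1); lra).
  exists (Rpower K' (- / e)). split; [apply Rpower_pos |]. intros x Hx.
  apply Rle_lt_trans with K'; [apply Rmax_l |].
  rewrite Rpower_Ropp. apply Rinv_lt_cancel; [apply Rinv_0_lt_compat, Rpower_pos |].
  rewrite Rinv_inv.
  apply Rlt_le_trans with (Rpower (Rpower K' (- / e)) e); [apply Rlt_Rpower_l; lra |].
  rewrite Rpower_mult. replace (- / e * e) with (- (1)) by (field; lra).
  rewrite Rpower_Ropp, Rpower_1 by trivial. lra.
Qed.

(** Keeping s = |lam| eta at least 1/2 makes every later division by s cost at most a factor 2. *)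
Lemma near_endpoint (lam d : R) : lam <> 0 -> 0 < d ->
  exists h0, h0 < / Rabs lam /\
    forall h, 0 <= h -> h0 < h < / Rabs lam ->
      1 / 2 <= Rabs lam * h < 1 /\ 0 < 1 - Rabs lam * h < d.
Proof.
  intros Hl Hd. assert (P := Rabs_pos_lt lam Hl). set (m := Rabs lam) in *.
  assert (P' := Rinv_0_lt_compat m P). assert (Em : m * / m = 1) by (field; lra).
  exists (/ m * (1 - Rmin d (1 / 2))).
  assert (Hm : 0 < Rmin d (1 / 2)) by (apply Rmin_pos; lra).
  assert (M1 := Rmin_l d (1 / 2)). assert (M2 := Rmin_r d (1 / 2)).
  split.
  { rewrite <- (Rmult_1_r (/ m)) at 2. apply Rmult_lt_compat_l; lra. }
  intros h Hh0 [Hh1 Hh2].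
  apply (Rmult_lt_compat_l m) in Hh1; trivial. apply (Rmult_lt_compat_l m) in Hh2; trivial.
  rewrite <- Rmult_assoc, Em in Hh1. rewrite Em in Hh2. lra.
Qed.

(** * Estimates for lam > 1/2 *)

(** From exp y >= 1 + y and ln J <= J - 1, the density J^(-1/lam) is at least 1 + eta u0', which has
    mean 1. *)
Lemma wt_ge_1 (lam eta : R) : 0 < lam -> Rabs (lam * eta) < 1 -> 1 <= wt lam eta.
Proof.
  intros Hl H. assert (P := Rinv_0_lt_compat lam Hl).
  assert (C : is_RInt (fun a => 1 + eta * tri a) 0 1 1).
  { evar_last.
    - apply (is_RInt_plus (V := R_NormedModule)); [apply (is_RInt_const (V := R_NormedModule)) |].
      apply (is_RInt_scal (V := R_NormedModule) tri). apply (RInt_correct (V := R_CompleteNormedModule)).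
      apply (ex_RInt_continuous (V := R_CompleteNormedModule)). intros; apply tri_continuous.
    - rewrite RInt_tri. unfold plus, scal; simpl; unfold mult; simpl. ring. }
  assert (E := is_RInt_unique (V := R_CompleteNormedModule) _ _ _ _ C). rewrite <- E at 1.
  apply RInt_le; [lra | eexists; exact C | now apply kern_ex_RInt |].
  intros a _. unfold kern. assert (J := jac_pos lam eta a H). simpl. rewrite Rmult_1_l.
  assert (L : ln (jac lam eta a) <= - (lam * eta * tri a)).
  { assert (K := exp_ineq1_le (ln (jac lam eta a))). rewrite exp_ln in K by trivial.
    unfold jac in K at 2. lra. }
  apply Rle_trans with (2 := exp_ineq1_le _).
  apply (Rmult_le_compat_l (/ lam)) in L; [| lra].
  replace (/ lam * - (lam * eta * tri a)) with (- (eta * tri a)) in L by (field; lra). lra.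
Qed.

(** Split J^(-1/lam) = J^(r - 1/lam) J^(-r). The first factor is at most (1 - s)^(r - 1/lam) because
    J >= 1 - s; the second has a bounded integral because r < 1. *)
Lemma wt_upper (lam eta r : R) : 0 < r < 1 -> r * lam < 1 -> 1 / 2 <= lam * eta < 1 -> 0 < lam ->
  wt lam eta <= 2 / (1 - r) * Rpower (1 - lam * eta) (r - / lam).
Proof.
  intros Hr Hrl Hs Hl. set (s := lam * eta) in *.
  assert (H : Rabs (lam * eta) < 1) by (fold s; rewrite Rabs_pos_eq; lra).
  assert (Hq : r - / lam <= 0).
  { apply Rmult_le_reg_r with lam; trivial. rewrite Rmult_minus_distr_r, Rinv_l; lra. }
  set (A := Rpower (1 - s) (r - / lam)).
  assert (HA : 0 < A) by apply Rpower_pos.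
  (* Apply [kint_FTC] with exponent 1 - r: the right side is at most (1 + s)^(1 - r) <= 2, and 2 s
     >= 1. *)
  assert (M : kint lam (- r) 0 eta 1 <= 2 / (1 - r)).
  { assert (F := kint_FTC lam (1 - r) eta ltac:(fold s; lra) H). fold s in F.
    replace (1 - r - 1) with (- r) in F by ring.
    assert (P1 := Rpower_pos (1 - s) (1 - r)).
    assert (P2 : Rpower (1 + s) (1 - r) <= 2).
    { apply Rle_trans with (Rpower (1 + s) 1); [apply Rle_Rpower; lra |].
      rewrite Rpower_1; lra. }
    assert (P3 : 0 < kint lam (- r) 0 eta 1).
    { apply RInt_gt_0; [lra | intros; apply kern_0_pos | intros; now apply kern_continuous]. }
    apply Rmult_le_reg_r with (1 - r); [lra |]. unfold Rdiv.
    rewrite Rmult_assoc, Rinv_l by lra.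
    assert (0 <= (2 * s - 1) * ((1 - r) * kint lam (- r) 0 eta 1)).
    { apply Rmult_le_pos; [lra |]. apply Rmult_le_pos; lra. }
    lra. }
  apply Rle_trans with (A * kint lam (- r) 0 eta 1).
  - assert (E : RInt (fun a => A * kern lam (- r) 0 eta a) 0 1 = A * kint lam (- r) 0 eta 1).
    { apply (RInt_scal (V := R_CompleteNormedModule)). now apply kern_ex_RInt. }
    rewrite <- E. apply RInt_le; [lra | now apply kern_ex_RInt | |].
    + apply (ex_RInt_scal (V := R_CompleteNormedModule)). now apply kern_ex_RInt.
    + intros a _. unfold kern. simpl. rewrite !Rmult_1_l.
      assert (J := jac_bounds lam eta a). rewrite Rabs_pos_eq in J by (fold s; lra). fold s in J.
      replace (- / lam) with (r - / lam + - r) by ring. rewrite Rpower_plus.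
      apply Rmult_le_compat_r; [left; apply Rpower_pos |]. apply Rpower_le_neg; lra.
  - rewrite (Rmult_comm A). apply Rmult_le_compat_r; lra.
Qed.

(** The midpoint of the window from 2/(2 lam + 1) to min(1, 1/lam). It lies below 1/lam for every
    positive lam; lying below 1 is where lam > 1/2 enters. *)
Lemma exponent_choice (lam : R) : 1 / 2 < lam ->
  exists r, 0 < r < 1 /\ r * lam < 1 /\ 2 < r * (2 * lam + 1).
Proof.
  intros Hl. set (a := 2 / (2 * lam + 1)). set (b := Rmin 1 (/ lam)).
  assert (P : 0 < / lam) by (apply Rinv_0_lt_compat; lra).
  assert (Ea : a * (2 * lam + 1) = 2) by (unfold a; field; lra).
  assert (Ha : 0 < a) by (apply Rdiv_lt_0_compat; lra).
  assert (M1 := Rmin_l 1 (/ lam)). assert (M2 := Rmin_r 1 (/ lam)). fold b in M1, M2.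
  assert (Hab : a < b).
  { apply Rmin_glb_lt.
    - apply Rmult_lt_reg_r with (2 * lam + 1); lra.
    - apply Rmult_lt_reg_r with lam; [lra |]. rewrite Rinv_l; lra. }
  exists ((a + b) / 2). split; [lra |]. split.
  - apply Rlt_le_trans with (/ lam * lam); [| rewrite Rinv_l; lra].
    apply Rmult_lt_compat_r; lra.
  - apply Rle_lt_trans with (a * (2 * lam + 1)); [lra |]. apply Rmult_lt_compat_r; lra.
Qed.

Lemma wt_Rpower_ex_RInt (lam p a b : R) : lam <> 0 ->
  - / Rabs lam < a < / Rabs lam -> - / Rabs lam < b < / Rabs lam ->
  ex_RInt (fun z => Rpower (wt lam z) p) a b.
Proof.
  intros Hl Ha Hb. apply (ex_RInt_continuous (V := R_CompleteNormedModule)). intros z Hz.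
  apply wt_Rpower_continuous; trivial. apply Rabs_lam_mult; trivial.
  revert Hz. unfold Rmin, Rmax. destruct Rle_dec; lra.
Qed.

Lemma time_bounded_pos (lam : R) : 1 / 2 < lam ->
  exists B, forall h, 0 <= h < / Rabs lam ->
    RInt (fun z => Rpower (wt lam z) (2 * lam)) 0 h <= B.
Proof.
  intros Hl. destruct (exponent_choice lam Hl) as [r [Hr [Hrl Hr2]]].
  (* [wt_upper] gives F^(2 lam) <= C (1 - s)^(e - 1), integrable up to s = 1 because e > 0. *)
  set (e := 2 * lam * r - 1). assert (He : 0 < e) by (unfold e; lra).
  assert (Hl0 : lam <> 0) by lra. assert (Pl : 0 < / lam) by (apply Rinv_0_lt_compat; lra).
  set (C := Rpower (2 / (1 - r)) (2 * lam)).
  assert (HC : 0 < C) by apply Rpower_pos.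
  rewrite (Rabs_pos_eq lam) by lra.
  (* [h1] is the point s = 1/2 from which [wt_upper] applies; the integral over [0, h1] is one fixed
     number. *)
  set (g := fun z => Rpower (wt lam z) (2 * lam)). set (h1 := / lam / 2).
  assert (Hex : forall a b, - / lam < a < / lam -> - / lam < b < / lam -> ex_RInt g a b).
  { intros a b Ha Hb. apply (wt_Rpower_ex_RInt lam (2 * lam)); trivial; rewrite (Rabs_pos_eq lam) by lra; trivial. }
  assert (Hg0 : forall a b, a <= b -> - / lam < a < / lam -> - / lam < b < / lam -> 0 <= RInt g a b).
  { intros a b Hab Ha Hb. apply RInt_ge_0; trivial; [now apply Hex |].
    intros; left; apply Rpower_pos. }
  assert (Hg : forall z, h1 <= z < / lam -> g z <= C * Rpower (1 - lam * z) (e - 1)).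
  { intros z Hz. assert (Hs : 1 / 2 <= lam * z < 1).
    { split.
      - replace (1 / 2) with (lam * h1) by (unfold h1; field; lra). apply Rmult_le_compat_l; lra.
      - rewrite <- (Rinv_r lam) by lra. apply Rmult_lt_compat_l; lra. }
    assert (W := wt_upper lam z r Hr Hrl Hs ltac:(lra)).
    assert (W0 := wt_pos lam z ltac:(rewrite Rabs_pos_eq; lra)).
    unfold g. apply Rle_trans with (Rpower (2 / (1 - r) * Rpower (1 - lam * z) (r - / lam)) (2 * lam)).
    - apply Rle_Rpower_l; lra.
    - rewrite <- Rpower_mult_distr, Rpower_mult by (try apply Rpower_pos; apply Rdiv_lt_0_compat; lra).
      replace ((r - / lam) * (2 * lam)) with (e - 1) by (unfold e; field; lra). right. reflexivity. }
  assert (Hint : forall h, h1 <= h < / lam -> RInt g h1 h <= C / (lam * e)).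
  { intros h Hh.
    assert (Hx : forall z, 0 <= z <= h -> 0 < 1 - lam * z <= 1).
    { intros z Hz. assert (0 <= lam * z) by (apply Rmult_le_pos; lra).
      assert (lam * z < lam * / lam) by (apply Rmult_lt_compat_l; lra).
      rewrite Rinv_r in * by lra. lra. }
    assert (h1 > 0) by (unfold h1; lra).
    assert (E : is_RInt (fun z => C * Rpower (1 - lam * z) (e - 1)) h1 h
       (minus (- (C / (lam * e)) * Rpower (1 - lam * h) e) (- (C / (lam * e)) * Rpower (1 - lam * h1) e))).
    { apply (is_RInt_derive (fun z => - (C / (lam * e)) * Rpower (1 - lam * z) e)).
      - intros z Hz. rewrite Rmin_left, Rmax_right in Hz by lra.
        assert (Hz' := Hx z ltac:(lra)). rewrite Rpower_pred by lra.
        unfold Rpower. auto_derive; [lra |]. unfold Rminus in *. field. lra.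
      - intros z Hz. rewrite Rmin_left, Rmax_right in Hz by lra.
        assert (Hz' := Hx z ltac:(lra)).
        apply (ex_derive_continuous (fun z => C * Rpower (1 - lam * z) (e - 1))).
        unfold Rpower. auto_derive. lra. }
    apply Rle_trans with (RInt (fun z => C * Rpower (1 - lam * z) (e - 1)) h1 h).
    - apply RInt_le; [lra | apply Hex; lra | eexists; exact E |]. intros z Hz. apply Hg. lra.
    - rewrite (is_RInt_unique (V := R_CompleteNormedModule) _ _ _ _ E).
      unfold minus, plus, opp; simpl.
      assert (P1 := Rpower_pos (1 - lam * h) e).
      assert (P2 := Rpower_le_1_l (1 - lam * h1) e (Hx h1 ltac:(lra)) ltac:(lra)).
      assert (PC : 0 < C / (lam * e)) by (apply Rdiv_lt_0_compat; [trivial | apply Rmult_lt_0_compat; lra]).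
      assert (Q1 := Rmult_le_compat_l _ _ _ (Rlt_le _ _ PC) P2).
      assert (Q2 := Rmult_lt_0_compat _ _ PC P1). lra. }
  assert (PC : 0 < C / (lam * e)) by (apply Rdiv_lt_0_compat; [trivial | apply Rmult_lt_0_compat; lra]).
  exists (RInt g 0 h1 + C / (lam * e)). intros h Hh.
  assert (Hh1 : 0 < h1 < / lam) by (unfold h1; lra).
  destruct (Rle_lt_dec h1 h) as [K | K].
  - rewrite <- (RInt_Chasles (V := R_CompleteNormedModule) g 0 h1 h) by (apply Hex; lra).
    apply Rplus_le_compat_l. apply Hint. lra.
  - rewrite <- (RInt_Chasles (V := R_CompleteNormedModule) g 0 h h1) by (apply Hex; lra).
    assert (N := Hg0 h h1 ltac:(lra) ltac:(lra) ltac:(lra)).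
    unfold plus; simpl. lra.
Qed.

(** Serves with c = 2 lam at the maximum point, and with c = 2 lam + 1 away from it, where the extra
    power comes from F'/F. *)
Lemma wt_Rpower_lower (lam eta r c : R) : 0 < r < 1 -> r * lam < 1 -> 1 / 2 <= lam * eta < 1 ->
  0 < lam -> 0 <= c ->
  Rpower (2 / (1 - r)) (- c) * Rpower (1 - lam * eta) ((/ lam - r) * c) <= Rpower (wt lam eta) (- c).
Proof.
  intros Hr Hrl Hs Hl Hc. assert (W := wt_upper lam eta r Hr Hrl Hs Hl).
  assert (W0 := wt_pos lam eta ltac:(rewrite Rabs_pos_eq; lra)).
  replace ((/ lam - r) * c) with ((r - / lam) * - c) by ring.
  rewrite <- Rpower_mult, Rpower_mult_distr by (try apply Rpower_pos; apply Rdiv_lt_0_compat; lra).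
  apply Rpower_le_neg; lra.
Qed.

(** 1/J = 1/(1 - s) and F'/F can have the same order, so they cannot be estimated separately.
    [kint_by_parts] with p = -1/lam eliminates the integral of J^(-1/lam - 1) and turns the
    difference into a single product. *)
Lemma slope_max (lam eta : R) : 0 < lam -> 0 < lam * eta < 1 ->
  slope lam eta 0 = Rpower (wt lam eta) (- 2 * lam) *
    (lam / (lam * eta * (1 - lam * eta)) * (1 - Rpower (1 + lam * eta) (- / lam) / wt lam eta)).
Proof.
  intros Hl Hs. assert (H : Rabs (lam * eta) < 1) by (rewrite Rabs_pos_eq; lra).
  assert (W := wt_pos lam eta H).
  assert (E1 := wt1_wt lam eta H).
  assert (E2 := kint_by_parts lam (- / lam) eta H).
  change (kint lam (- / lam) 0 eta 1) with (wt lam eta) in E2.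
  unfold slope, jac. rewrite (tri_IZR 0). f_equal.
  set (s := lam * eta) in *. set (m := kint lam (- / lam - 1) 0 eta 1) in *.
  rewrite <- E2. replace (wt1 lam eta) with ((m - wt lam eta) / s) by (rewrite <- E1; field; lra).
  field. repeat split; lra.
Qed.

Lemma slope_max_diverges (lam K : R) : 1 / 2 < lam ->
  exists h0, h0 < / Rabs lam /\
    forall h, 0 <= h -> h0 < h < / Rabs lam -> K < slope lam h 0.
Proof.
  intros Hl. destruct (exponent_choice lam Hl) as [r [Hr [Hrl Hr2]]].
  assert (Pl : 0 < / lam) by (apply Rinv_0_lt_compat; lra).
  (* With s >= 1/2 and F >= 1, the subtracted term in [slope_max] stays below w < 1. *)
  set (w := Rpower (3 / 2) (- / lam)).
  assert (Hw : w < 1).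
  { unfold w. rewrite <- (Rpower_O (3 / 2)) by lra. apply Rpower_lt; lra. }
  set (c := Rpower (2 / (1 - r)) (- (2 * lam)) * (lam * (1 - w))).
  assert (Hc : 0 < c) by (apply Rmult_lt_0_compat; [apply Rpower_pos | apply Rmult_lt_0_compat; lra]).
  (* The exponent is that of F^(-2 lam)/(1 - s), bounded below by a multiple of (1 - s)^(1 - 2 lam
     r). *)
  destruct (Rpower_diverges (2 * lam * r - 1) (K / c)) as [d [Hd Hd']]; [lra |].
  destruct (near_endpoint lam d ltac:(lra) Hd) as [h0 [Hh0 Hn]].
  exists h0. split; trivial. intros h Hh Hh'. destruct (Hn h Hh Hh') as [Hs Hx].
  rewrite (Rabs_pos_eq lam) in Hs, Hx by lra.
  rewrite slope_max by lra.
  assert (H : Rabs (lam * h) < 1) by (rewrite Rabs_pos_eq; lra).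
  assert (W := wt_ge_1 lam h ltac:(lra) H).
  assert (L := wt_Rpower_lower lam h r (2 * lam) Hr Hrl Hs ltac:(lra) ltac:(lra)).
  set (s := lam * h) in *.
  assert (Q : lam * (1 - w) / (1 - s) <=
     lam / (s * (1 - s)) * (1 - Rpower (1 + s) (- / lam) / wt lam h)).
  { assert (Q1 : Rpower (1 + s) (- / lam) / wt lam h <= w).
    { apply Rle_trans with (Rpower (1 + s) (- / lam)).
      - rewrite <- (Rmult_1_r (Rpower (1 + s) (- / lam))) at 2.
        apply Rmult_le_compat_l; [left; apply Rpower_pos |].
        rewrite <- Rinv_1. apply Rinv_le_contravar; lra.
      - apply Rpower_le_neg; lra. }
    assert (Q2 : lam / (1 - s) <= lam / (s * (1 - s))).
    { apply Rmult_le_compat_l; [lra |]. apply Rinv_le_contravar.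
      - apply Rmult_lt_0_compat; lra.
      - rewrite <- (Rmult_1_l (1 - s)) at 2. apply Rmult_le_compat_r; lra. }
    assert (Q3 : 0 < lam / (1 - s)) by (apply Rdiv_lt_0_compat; lra).
    replace (lam * (1 - w) / (1 - s)) with (lam / (1 - s) * (1 - w)) by (field; lra).
    apply Rmult_le_compat; lra. }
  apply Rlt_le_trans with (c * Rpower (1 - s) (- (2 * lam * r - 1))).
  - specialize (Hd' (1 - s) Hx). apply (Rmult_lt_compat_l c) in Hd'; trivial.
    replace (c * (K / c)) with K in Hd' by (field; lra). exact Hd'.
  - replace (- 2 * lam) with (- (2 * lam)) by ring.
    replace (- (2 * lam * r - 1)) with ((/ lam - r) * (2 * lam) - 1) by (field; lra).
    rewrite Rpower_pred by lra.
    replace (c * (Rpower (1 - s) ((/ lam - r) * (2 * lam)) / (1 - s)))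
      with (Rpower (2 / (1 - r)) (- (2 * lam)) * Rpower (1 - s) ((/ lam - r) * (2 * lam)) *
            (lam * (1 - w) / (1 - s))) by (unfold c; field; lra).
    apply Rmult_le_compat; trivial.
    + apply Rmult_le_pos; left; apply Rpower_pos.
    + left. apply Rdiv_lt_0_compat; [apply Rmult_lt_0_compat |]; lra.
Qed.

(** u0'/J is bounded above once u0'(a) < 1, while the common term F^(-2 lam) F'/F tends to infinity;
    the label enters only through [C1]. *)
Lemma slope_away_from_max (lam a K : R) : 1 / 2 < lam -> tri a < 1 ->
  exists h0, h0 < / Rabs lam /\
    forall h, 0 <= h -> h0 < h < / Rabs lam -> slope lam h a < K.
Proof.
  intros Hl Ha. destruct (exponent_choice lam Hl) as [r [Hr [Hrl Hr2]]].
  assert (Pl : 0 < / lam) by (apply Rinv_0_lt_compat; lra).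
  set (v := tri a). fold v in Ha.
  (* 1/(1 - v) bounds u0'/J, and lam/2 + 2 is the loss in bounding F'/F below by (lam/2) (1 -
     s)^(-1/lam) / F. *)
  set (C1 := / (1 - v) + lam / 2 + 2).
  set (c := lam / 2 * Rpower (2 / (1 - r)) (- (2 * lam + 1))).
  assert (Hc : 0 < c) by (apply Rmult_lt_0_compat; [lra | apply Rpower_pos]).
  assert (HC1 : 0 < C1) by (assert (0 < / (1 - v)) by (apply Rinv_0_lt_compat; lra); unfold C1; lra).
  (* This is -1/lam + (1/lam - r) (2 lam + 1) with its sign reversed, the terms in 1/lam
     cancelling. *)
  destruct (Rpower_diverges (r * (2 * lam + 1) - 2) ((C1 - K) / c)) as [d [Hd Hd']]; [lra |].
  destruct (near_endpoint lam d ltac:(lra) Hd) as [h0 [Hh0 Hn]].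
  exists h0. split; trivial. intros h Hh Hh'. destruct (Hn h Hh Hh') as [Hs Hx].
  rewrite (Rabs_pos_eq lam) in Hs, Hx by lra.
  assert (H : Rabs (lam * h) < 1) by (rewrite Rabs_pos_eq; lra).
  assert (W := wt_ge_1 lam h ltac:(lra) H).
  assert (L := wt_Rpower_lower lam h r (2 * lam + 1) Hr Hrl Hs ltac:(lra) ltac:(lra)).
  assert (E1 := wt1_wt lam h H).
  assert (E2 := kint_FTC lam (- / lam) h ltac:(lra) H).
  unfold slope, jac. fold v. replace (- 2 * lam) with (- (2 * lam)) by ring.
  set (s := lam * h) in *. set (F := wt lam h) in *. set (F1 := wt1 lam h) in *.
  set (m := kint lam (- / lam - 1) 0 h 1) in *.
  set (X := Rpower (1 - s) (- / lam)) in *. set (P := Rpower F (- (2 * lam))).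
  assert (HP : 0 < P) by apply Rpower_pos. assert (HX : 0 < X) by apply Rpower_pos.
  assert (HP1 : P <= 1) by (apply Rpower_le_1_r; lra).
  assert (HPF : Rpower F (- (2 * lam + 1)) = P / F).
  { unfold P. rewrite <- Rpower_pred by lra. f_equal. ring. }
  assert (Hv : v / (1 - s * v) <= / (1 - v)).
  { assert (J := jac_pos lam h a H). unfold jac in J. fold s v in J.
    apply Rmult_le_reg_r with ((1 - s * v) * (1 - v)); [apply Rmult_lt_0_compat; lra |].
    replace (v / (1 - s * v) * ((1 - s * v) * (1 - v))) with (v * (1 - v)) by (field; lra).
    replace (/ (1 - v) * ((1 - s * v) * (1 - v))) with (1 - s * v) by (field; lra).
    destruct (Rle_lt_dec 0 v) as [Q | Q].
    - assert (0 <= (1 - s) * v) by (apply Rmult_le_pos; lra).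
      assert (0 <= (1 - v) * (1 - v)) by (apply Rmult_le_pos; lra). lra.
    - assert (0 <= s * - v) by (apply Rmult_le_pos; lra).
      assert (0 <= - v * - v) by (apply Rmult_le_pos; lra). lra. }
  assert (Hm0 : 0 < m).
  { apply RInt_gt_0; [lra | intros; apply kern_0_pos | intros; now apply kern_continuous]. }
  assert (Hm : lam / 2 * (X - 1) <= m).
  { assert (B : Rpower (1 + s) (- / lam) <= 1) by (apply Rpower_le_1_r; lra).
    assert (B2 : 1 <= X).
    { unfold X. rewrite <- (Rpower_base1 (- / lam)) at 1. apply Rpower_le_neg; lra. }
    assert (E3 : 2 * s * m = lam * (X - Rpower (1 + s) (- / lam))).
    { replace (2 * s * m) with (- lam * (2 * s * - / lam * m)) by (field; lra). rewrite E2. ring. }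
    assert (B3 : lam * (X - 1) <= lam * (X - Rpower (1 + s) (- / lam))) by (apply Rmult_le_compat_l; lra).
    assert (B4 : 0 <= lam * (X - 1)) by (apply Rmult_le_pos; lra).
    assert (B6 : s * m <= 1 * m) by (apply Rmult_le_compat_r; lra). lra. }
  assert (HF1 : lam / 2 * X / F - (lam / 2 + 2) <= F1 / F).
  { apply Rmult_le_reg_r with F; [lra |].
    replace ((lam / 2 * X / F - (lam / 2 + 2)) * F) with (lam / 2 * X - (lam / 2 + 2) * F) by (field; lra).
    replace (F1 / F * F) with F1 by (field; lra).
    assert (HF : lam / 2 * 1 <= lam / 2 * F) by (apply Rmult_le_compat_l; lra).
    (* s F' = m - F. If m >= F then s <= 1 gives F' >= m - F; otherwise the right side is negative
       and s >= 1/2 gives F' >= 2 (m - F). *)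
    destruct (Rle_lt_dec F m) as [Q | Q].
    - assert (s * F1 <= 1 * F1); [| lra]. apply Rmult_le_compat_r; [| lra].
      apply Rmult_le_reg_l with s; lra.
    - assert (2 * m - 2 * F <= F1).
      { apply Rmult_le_reg_l with s; [lra |]. rewrite E1.
        assert (0 <= (2 * s - 1) * (F - m)) by (apply Rmult_le_pos; lra). lra. }
      lra. }
  apply Rle_lt_trans with (P * (C1 - lam / 2 * X / F)).
  { apply Rmult_le_compat_l; [lra |]. unfold C1. lra. }
  apply Rle_lt_trans with (C1 - lam / 2 * X * (P / F)).
  { replace (P * (C1 - lam / 2 * X / F)) with (P * C1 - lam / 2 * X * (P / F)) by (field; lra).
    assert (P * C1 <= 1 * C1) by (apply Rmult_le_compat_r; lra). lra. }
  rewrite HPF in L. assert (HlX : 0 < lam / 2 * X) by (apply Rmult_lt_0_compat; lra).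
  apply (Rmult_le_compat_l (lam / 2 * X)) in L; [| lra].
  specialize (Hd' (1 - s) Hx). apply (Rmult_lt_compat_l c) in Hd'; trivial.
  replace (c * ((C1 - K) / c)) with (C1 - K) in Hd' by (field; lra).
  replace (- (r * (2 * lam + 1) - 2)) with (- / lam + (/ lam - r) * (2 * lam + 1)) in Hd' by (field; lra).
  rewrite Rpower_plus in Hd'. fold X in Hd'. unfold c in Hd'. lra.
Qed.

(** * Estimates for lam < 0 *)

(** Now k = -1/lam is positive, so J <= 2 gives the upper bound. For the lower one, [kint_FTC] with
    exponent k + 1 compares (1 - s)^(k+1) - (1 + s)^(k+1) with (1 - s) - (1 + s), where s = lam eta
    < 0. That identity degenerates at eta = 0, where F = 1. *)
Lemma wt_bounds_neg (lam eta : R) : lam < 0 -> 0 <= eta -> Rabs (lam * eta) < 1 ->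
  / (- / lam + 1) <= wt lam eta <= Rpower 2 (- / lam).
Proof.
  intros Hl He H. assert (Pk : 0 < - / lam) by (rewrite <- Rinv_opp; apply Rinv_0_lt_compat; lra).
  set (k := - / lam) in *. split.
  - destruct He as [He | <-].
    + assert (Hs : lam * eta < 0).
      { assert (0 < - lam * eta) by (apply Rmult_lt_0_compat; lra). lra. }
      assert (F := kint_FTC lam (k + 1) eta ltac:(lra) H).
      replace (k + 1 - 1) with k in F by ring.
      change (kint lam k 0 eta 1) with (wt lam eta) in F. set (s := lam * eta) in *.
      rewrite Rabs_left in H by trivial.
      rewrite !Rpower_plus, !Rpower_1 in F by lra.
      assert (Q1 : Rpower (1 + s) k <= 1) by (apply Rpower_le_1_l; lra).
      assert (Q2 : 1 <= Rpower (1 - s) k).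
      { rewrite <- (Rpower_base1 k) at 1. apply Rle_Rpower_l; lra. }
      apply (Rmult_le_compat_r (1 + s)) in Q1; [| lra].
      apply (Rmult_le_compat_r (1 - s)) in Q2; [| lra].
      apply Rmult_le_reg_l with ((k + 1) * - s); [apply Rmult_lt_0_compat; lra |].
      replace ((k + 1) * - s * / (k + 1)) with (- s) by (field; lra). lra.
    + rewrite wt_0. rewrite <- Rinv_1. apply Rinv_le_contravar; lra.
  - replace (Rpower 2 k) with (RInt (fun _ => Rpower 2 k) 0 1).
    + apply RInt_le; [lra | now apply kern_ex_RInt | apply ex_RInt_const |].
      intros a _. unfold kern. simpl. rewrite Rmult_1_l. fold k.
      assert (J := jac_bounds lam eta a). apply Rle_Rpower_l; lra.
    + rewrite RInt_const. unfold scal; simpl; unfold mult; simpl. ring.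
Qed.

Lemma time_bounded_neg (lam : R) : lam < 0 ->
  exists B, forall h, 0 <= h < / Rabs lam ->
    RInt (fun z => Rpower (wt lam z) (2 * lam)) 0 h <= B.
Proof.
  intros Hl. assert (Pk : 0 < - / lam) by (rewrite <- Rinv_opp; apply Rinv_0_lt_compat; lra).
  set (C := Rpower (/ (- / lam + 1)) (2 * lam)). assert (HC : 0 < C) by apply Rpower_pos.
  exists (C * / Rabs lam). intros h Hh.
  apply Rle_trans with (RInt (fun _ => C) 0 h).
  - apply RInt_le; [lra | | apply ex_RInt_const |].
    + apply wt_Rpower_ex_RInt; lra.
    + intros z Hz. apply Rpower_le_neg; [apply Rinv_0_lt_compat; lra | | lra].
      apply wt_bounds_neg; try lra. apply Rabs_lam_mult; lra.
  - rewrite RInt_const. unfold scal; simpl; unfold mult; simpl.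
    rewrite Rmult_comm. apply Rmult_le_compat_l; lra.
Qed.

(** The exponent -1/lam - 1 is negative for lam < -1, so no pointwise bound survives up to the
    endpoint. For |lam eta| >= 1/2 the explicit integral gives |lam| 2^(-1/lam); below 1/2, J >= 1/2
    gives twice 2^(-1/lam). The constant adds the two. *)
Lemma wt1_bound_neg (lam eta : R) : lam < 0 -> 0 <= eta -> Rabs (lam * eta) < 1 ->
  Rabs (wt1 lam eta) <= Rpower 2 (- / lam) * (2 + - lam).
Proof.
  intros Hl He H. assert (Pk : 0 < - / lam) by (rewrite <- Rinv_opp; apply Rinv_0_lt_compat; lra).
  set (m := kint lam (- / lam - 1) 0 eta 1).
  assert (C : forall p j, is_RInt (kern lam p j eta) 0 1 (kint lam p j eta 1)).
  { intros p j. apply (RInt_correct (V := R_CompleteNormedModule)). now apply kern_ex_RInt. }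
  assert (Hs : lam * eta <= 0).
  { assert (0 <= - lam * eta) by (apply Rmult_le_pos; lra). lra. }
  set (D := Rpower 2 (- / lam)). assert (HD : 0 < D) by apply Rpower_pos.
  apply Rle_trans with m.
  - apply (norm_RInt_le (V := R_NormedModule) (kern lam (- / lam - 1) 1 eta)
      (kern lam (- / lam - 1) 0 eta) 0 1); [lra | | apply C | apply C].
    intros a _. unfold kern, norm; simpl; unfold abs; simpl.
    rewrite Rabs_mult, (Rabs_pos_eq (Rpower _ _)) by (left; apply Rpower_pos).
    apply Rmult_le_compat_r; [left; apply Rpower_pos |].
    rewrite Rmult_1_r. apply Rabs_le, tri_bounds.
  - destruct (Rle_lt_dec (1 / 2) (Rabs (lam * eta))) as [Q | Q].
    + rewrite Rabs_left1 in Q, H by trivial.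
      assert (F := kint_FTC lam (- / lam) eta ltac:(lra) ltac:(rewrite Rabs_left1; lra)).
      fold m in F. set (s := lam * eta) in *.
      assert (P1 := Rpower_pos (1 + s) (- / lam)).
      assert (P2 : Rpower (1 - s) (- / lam) <= D) by (apply Rle_Rpower_l; lra).
      assert (Hm : 0 < m).
      { apply RInt_gt_0; [lra | intros; apply kern_0_pos |].
        intros; apply kern_continuous. fold s. rewrite Rabs_left1; lra. }
      assert (E : 2 * - s * m <= - lam * D).
      { replace (2 * - s * m) with (lam * (2 * s * - / lam * m)) by (field; lra).
        rewrite F. rewrite <- (Rmult_opp_opp lam). apply Rmult_le_compat_l; lra. }
      assert (0 <= (2 * - s - 1) * m) by (apply Rmult_le_pos; lra). lra.
    + apply Rle_trans with (2 * D).
      * replace (2 * D) with (RInt (fun _ => 2 * D) 0 1).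
        -- apply RInt_le; [lra | now apply kern_ex_RInt | apply ex_RInt_const |].
           intros a _. unfold kern. simpl. rewrite Rmult_1_l.
           assert (J := jac_bounds lam eta a). rewrite Rpower_pred by lra.
           unfold Rdiv. rewrite Rmult_comm. apply Rmult_le_compat.
           ++ left. apply Rinv_0_lt_compat. lra.
           ++ left. apply Rpower_pos.
           ++ rewrite <- (Rinv_inv 2). apply Rinv_le_contravar; lra.
           ++ apply Rle_Rpower_l; lra.
        -- rewrite RInt_const. unfold scal; simpl; unfold mult; simpl. ring.
      * assert (0 <= D * - lam) by (apply Rmult_le_pos; lra). lra.
Qed.

Lemma wt1_wt_bound_neg (lam : R) : lam < 0 -> exists C, 0 < C /\
  forall eta, 0 <= eta -> Rabs (lam * eta) < 1 -> Rabs (wt1 lam eta / wt lam eta) <= C.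
Proof.
  intros Hl. assert (Pk : 0 < - / lam) by (rewrite <- Rinv_opp; apply Rinv_0_lt_compat; lra).
  set (A := Rpower 2 (- / lam) * (2 + - lam)).
  assert (HA : 0 < A) by (apply Rmult_lt_0_compat; [apply Rpower_pos | lra]).
  exists (A * (- / lam + 1)). split; [apply Rmult_lt_0_compat; lra |].
  intros eta He H. assert (W := wt_bounds_neg lam eta Hl He H). assert (W0 := wt_pos lam eta H).
  unfold Rdiv. rewrite Rabs_mult. apply Rmult_le_compat; try apply Rabs_pos.
  - now apply wt1_bound_neg.
  - rewrite Rabs_pos_eq by (left; now apply Rinv_0_lt_compat).
    rewrite <- (Rinv_inv (- / lam + 1)). apply Rinv_le_contravar; [apply Rinv_0_lt_compat |]; lra.
Qed.

Lemma slope_at_min (lam a K : R) : lam < 0 -> tri a = -1 ->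
  exists h0, h0 < / Rabs lam /\
    forall h, 0 <= h -> h0 < h < / Rabs lam -> slope lam h a < K.
Proof.
  intros Hl Ha. assert (Pk : 0 < - / lam) by (rewrite <- Rinv_opp; apply Rinv_0_lt_compat; lra).
  destruct (wt1_wt_bound_neg lam Hl) as [C [HC HC']].
  set (P0 := Rpower (/ (- / lam + 1)) (- 2 * lam)). assert (HP0 : 0 < P0) by apply Rpower_pos.
  (* Once 1/J > N, the bracket -1/J - F'/F is below -(|K|/P0 + 1); multiplied by a prefactor at
     least [P0], it falls below -|K| - P0 < K. *)
  set (N := C + Rabs K / P0 + 1).
  assert (HKP : 0 <= Rabs K / P0) by (apply Rdiv_le_0_compat; [apply Rabs_pos | trivial]).
  assert (HN : 0 < / N) by (apply Rinv_0_lt_compat; unfold N; lra).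
  destruct (near_endpoint lam (/ N) ltac:(lra) HN) as [h0 [Hh0 Hn]].
  exists h0. split; trivial. intros h Hh Hh'. destruct (Hn h Hh Hh') as [Hs Hx].
  rewrite Rabs_left in Hs, Hx by trivial.
  assert (H : Rabs (lam * h) < 1) by (rewrite Rabs_left; lra).
  assert (W := wt_bounds_neg lam h Hl Hh H). assert (Q := HC' h Hh H).
  apply Rabs_le_between in Q.
  unfold slope, jac. rewrite Ha. replace (1 - lam * h * -1) with (1 - - lam * h) by ring.
  set (x := 1 - - lam * h) in *.
  assert (PP : P0 <= Rpower (wt lam h) (- 2 * lam)).
  { apply Rle_Rpower_l; [lra |]. split; [apply Rinv_0_lt_compat |]; lra. }
  assert (Hix : N < / x).
  { rewrite <- (Rinv_inv N). apply Rinv_lt_contravar; [apply Rmult_lt_0_compat |]; lra. }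
  assert (Y : -1 / x - wt1 lam h / wt lam h <= - (Rabs K / P0 + 1)).
  { unfold Rdiv at 1. unfold N in Hix. lra. }
  apply Rle_lt_trans with (P0 * - (Rabs K / P0 + 1)).
  - set (y := -1 / x - wt1 lam h / wt lam h) in *.
    apply Rle_trans with (P0 * y); [| apply Rmult_le_compat_l; lra].
    assert (0 <= (Rpower (wt lam h) (- 2 * lam) - P0) * - y) by (apply Rmult_le_pos; lra). lra.
  - replace (P0 * - (Rabs K / P0 + 1)) with (- Rabs K - P0) by (field; lra).
    assert (B := Rle_abs (- K)). rewrite Rabs_Ropp in B. lra.
Qed.

Lemma slope_bounded_neg (lam a : R) : lam < 0 -> -1 < tri a ->
  exists B, forall h, 0 <= h < / Rabs lam -> Rabs (slope lam h a) <= B.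
Proof.
  intros Hl Ha. assert (Pk : 0 < - / lam) by (rewrite <- Rinv_opp; apply Rinv_0_lt_compat; lra).
  destruct (wt1_wt_bound_neg lam Hl) as [C [HC HC']].
  exists (Rpower (Rpower 2 (- / lam)) (- 2 * lam) * (2 / (1 + tri a) + C)).
  intros h Hh. assert (H : Rabs (lam * h) < 1) by (apply Rabs_lam_mult; lra).
  assert (W := wt_bounds_neg lam h Hl ltac:(lra) H). assert (W0 := wt_pos lam h H).
  unfold slope. rewrite Rabs_mult.
  rewrite (Rabs_pos_eq (Rpower _ _)) by (left; apply Rpower_pos).
  apply Rmult_le_compat; [left; apply Rpower_pos | apply Rabs_pos | apply Rle_Rpower_l; lra |].
  apply Rle_trans with (1 := Rabs_triang _ _). rewrite Rabs_Ropp.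
  apply Rplus_le_compat; [| apply HC'; trivial; lra].
  assert (J := jac_pos lam h a H). assert (B := tri_bounds a).
  unfold Rdiv. rewrite Rabs_mult, (Rabs_pos_eq (/ _)) by (left; now apply Rinv_0_lt_compat).
  apply Rle_trans with (1 * / jac lam h a).
  - apply Rmult_le_compat_r; [left; now apply Rinv_0_lt_compat |]. now apply Rabs_le.
  (* J = 1 + |lam| h u0'(a) is at least 1 when u0'(a) >= 0 and at least 1 + u0'(a) otherwise; both
     exceed (1 + u0'(a))/2 or equal it. *)
  - rewrite Rmult_1_l. replace (2 * / (1 + tri a)) with (/ ((1 + tri a) / 2)) by (field; lra).
    apply Rinv_le_contravar; [lra |].
    assert (Hs : 0 <= - lam * h) by (apply Rmult_le_pos; lra).
    rewrite Rabs_left1 in H by lra. unfold jac in *. set (s := - lam * h) in *.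
    replace (lam * h) with (- s) in * by (unfold s; ring).
    destruct (Rle_lt_dec 0 (tri a)) as [Q | Q].
    + assert (0 <= s * tri a) by (now apply Rmult_le_pos). lra.
    + assert (0 <= (1 - s) * - tri a) by (apply Rmult_le_pos; lra). lra.
Qed.

(** * Admissibility of the datum and the final assembly *)

Lemma tri_admissible : admissible_data tri_prim tri.
Proof.
  assert (Hex : forall a b, ex_RInt tri a b).
  { intros a b. apply (ex_RInt_continuous (V := R_CompleteNormedModule)). intros; apply tri_continuous. }
  assert (HD : forall x, is_derive tri_prim x (tri x)).
  { intros x. apply (is_derive_RInt tri tri_prim 0); [| apply tri_continuous].
    apply filter_forall. intros y. apply (RInt_correct (V := R_CompleteNormedModule)), Hex. }
  assert (H0 : Rabs (0 * 0) < 1) by (rewrite Rmult_0_r, Rabs_R0; lra).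
  assert (Hper : periodic1 tri_prim).
  { intros x. unfold tri_prim. rewrite <- !(kint_10 0 0), kint_add1 by trivial.
    rewrite !kint_10, RInt_tri. ring. }
  repeat split; trivial.
  - intros x. apply is_derive_Reals, HD.
  - apply tri_continuity.
  - assert (Hc : forall x, continuous tri_prim x).
    { intros x. apply (ex_derive_continuous tri_prim). eexists. apply HD. }
    assert (Hex' : forall a b, ex_RInt tri_prim a b).
    { intros a b. apply (ex_RInt_continuous (V := R_CompleteNormedModule)). intros; apply Hc. }
    (* Symmetry of [tri] about 1/2 and its zero mean make the primitive odd about 1/2, which gives
       mean zero. *)
    assert (Hodd : forall x, tri_prim (1 - x) = - tri_prim x).
    { intros x. unfold tri_prim.
      assert (E := RInt_comp_lin tri (- 1) 1 x 1 (Hex _ _)).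
      replace (- 1 * x + 1) with (1 - x) in E by ring. replace (- 1 * 1 + 1) with 0 in E by ring.
      rewrite (RInt_ext (fun y => scal (- 1) (tri (- 1 * y + 1))) (fun y => scal (- 1) (tri y))) in E.
      - rewrite (RInt_scal (V := R_CompleteNormedModule)) in E by apply Hex.
        rewrite <- (opp_RInt_swap (V := R_CompleteNormedModule) tri (1 - x) 0), <- E by apply Hex.
        assert (Z := RInt_tri).
        rewrite <- (RInt_Chasles (V := R_CompleteNormedModule) tri 0 x 1) in Z by apply Hex.
        unfold plus, opp, scal in *; simpl in *; unfold mult; simpl. lra.
      - intros y _. replace (- 1 * y + 1) with (1 - y) by ring. now rewrite tri_refl. }
    exists (ex_RInt_Reals_0 _ _ _ (Hex' 0 1)). rewrite <- RInt_Reals.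
    assert (E := RInt_comp_lin tri_prim (- 1) 1 0 1 (Hex' _ _)).
    replace (- 1 * 0 + 1) with 1 in E by ring. replace (- 1 * 1 + 1) with 0 in E by ring.
    rewrite (RInt_ext (fun y => scal (- 1) (tri_prim (- 1 * y + 1))) tri_prim) in E.
    + rewrite <- (opp_RInt_swap (V := R_CompleteNormedModule) tri_prim 0 1) in E by apply Hex'.
      unfold opp in E; simpl in E. lra.
    + intros y _. replace (- 1 * y + 1) with (1 - y) by ring. rewrite Hodd.
      unfold scal; simpl; unfold mult; simpl. ring.
  - exists 2%nat, (fun i => INR i / 2), (fun i => match i with O => -4 | _ => 4 end).
    split; [simpl; field |]. split; [simpl; field |]. split.
    + intros i _. rewrite S_INR. lra.
    + intros i x Hi Hx. apply is_derive_Reals.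
      destruct i as [| [| i]]; [| | lia]; simpl in Hx.
      * apply is_derive_ext_loc with (fun y => 1 - 4 * y); [| auto_derive; trivial; ring].
        apply (locally_interval _ x 0 (1 / 2)); simpl; try lra.
        intros y Hy1 Hy2. symmetry. apply tri_left. lra.
      * apply is_derive_ext_loc with (fun y => 1 - 4 * (1 - y)); [| auto_derive; trivial; ring].
        apply (locally_interval _ x (1 / 2) 1); simpl; try lra.
        intros y Hy1 Hy2. rewrite <- tri_refl. symmetry. apply tri_left. lra.
Qed.

Lemma tri_min_iff (x : R) : (forall y, tri x <= tri y) <-> tri x = -1.
Proof.
  split.
  - intros H. specialize (H (1 / 2 + IZR 0)). rewrite tri_half in H.
    assert (B := tri_bounds x). lra.
  - intros -> y. apply tri_bounds.
Qed.

Theorem mainTheorem6 :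
  exists (u0 u0p : R -> R) (a0 : R) (L : list R),
    admissible_data u0 u0p /\
    (* a0 is the (unique mod 1) maximum point of u0' *)
    (forall x, u0p x <= u0p a0) /\
    (forall x, u0p x = u0p a0 -> exists k : Z, x = a0 + IZR k) /\
    (* the minimum points of u0' are finitely many (mod 1), listed in L *)
    (forall x, (forall y, u0p x <= u0p y) <->
               exists a k, In a L /\ x = a + IZR k) /\
    (forall lam, 1 / 2 < lam ->
       exists ts (u ux gam : R -> R -> R),
         0 < ts /\ is_solution lam u0 ts u ux gam /\
         M_to_pinf ux gam ts /\
         (forall a, (forall k : Z, a <> a0 + IZR k) ->
            to_minf_left (fun t => ux (gam a t) t) ts)) /\
    (forall lam, lam < 0 ->
       exists ts (u ux gam : R -> R -> R),
         0 < ts /\ is_solution lam u0 ts u ux gam /\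
         m_to_minf ux gam ts /\
         (forall a, (forall y, u0p a <= u0p y) ->
            to_minf_left (fun t => ux (gam a t) t) ts) /\
         (forall a, ~ (forall y, u0p a <= u0p y) ->
            exists B, forall t, 0 <= t < ts -> Rabs (ux (gam a t) t) <= B)).
Proof.
  exists tri_prim, tri, 0, (cons (1 / 2) nil).
  split; [exact tri_admissible |].
  split; [intros x; rewrite (tri_IZR 0); apply tri_bounds |].
  split.
  { intros x. rewrite (tri_IZR 0). intros Hx. destruct (tri_eq_1 x Hx) as [k ->].
    exists k. ring. }
  split.
  { intros x. rewrite tri_min_iff. split.
    - intros Hx. destruct (tri_eq_m1 x Hx) as [k Hk]. exists (1 / 2), k. split; [now left | trivial].
    - intros [a [k [[<- | []] ->]]]. apply tri_half. }
  split.
  - intros lam Hl. destruct (time_bounded_pos lam Hl) as [B HB].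
    destruct (solution_exists lam B ltac:(lra) HB) as (ts & u & ux & gam & H & Hts & Hsol & HH & Hux & HE).
    exists ts, u, ux, gam. split; [trivial |]. split; [trivial |]. split.
    + intros K. destruct (slope_max_diverges lam K Hl) as [h0 [Hh0 Hs]].
      destruct (HE h0 Hh0) as [d [Hd Hd']]. exists d. split; trivial.
      (* The supremum is bounded below by its value at the maximum point 0 of u0'. *)
      intros t Ht0 Ht. exists 0. assert (Hr := HH t ltac:(lra)). assert (Hd1 := Hd' t Ht0 Ht).
      rewrite Hux by lra. apply Hs; lra.
    + intros a Ha K. assert (Hv : tri a < 1).
      { destruct (tri_bounds a) as [_ [Hv | Hv]]; trivial.
        destruct (tri_eq_1 a Hv) as [k Hk]. exfalso. apply (Ha k). lra. }
      destruct (slope_away_from_max lam a K Hl Hv) as [h0 [Hh0 Hs]].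
      destruct (HE h0 Hh0) as [d [Hd Hd']]. exists d. split; trivial.
      intros t Ht0 Ht. assert (Hr := HH t ltac:(lra)). assert (Hd1 := Hd' t Ht0 Ht).
      rewrite Hux by lra. apply Hs; lra.
  - intros lam Hl. destruct (time_bounded_neg lam Hl) as [B HB].
    destruct (solution_exists lam B ltac:(lra) HB) as (ts & u & ux & gam & H & Hts & Hsol & HH & Hux & HE).
    exists ts, u, ux, gam. split; [trivial |]. split; [trivial |].
    assert (Hmin : forall a, tri a = -1 -> to_minf_left (fun t => ux (gam a t) t) ts).
    { intros a Ha K. destruct (slope_at_min lam a K Hl Ha) as [h0 [Hh0 Hs]].
      destruct (HE h0 Hh0) as [d [Hd Hd']]. exists d. split; trivial.
      intros t Ht0 Ht. assert (Hr := HH t ltac:(lra)). assert (Hd1 := Hd' t Ht0 Ht).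
      rewrite Hux by lra. apply Hs; lra. }
    split; [| split].
    + intros K. destruct (Hmin (1 / 2 + IZR 0) (tri_half 0) K) as [d [Hd Hd']].
      exists d. split; trivial. intros t Ht0 Ht. exists (1 / 2 + IZR 0). now apply Hd'.
    + intros a Ha. apply Hmin. now apply tri_min_iff.
    + intros a Ha. assert (Hv : -1 < tri a).
      { destruct (tri_bounds a) as [[Hv | Hv] _]; trivial.
        exfalso. apply Ha, tri_min_iff. now symmetry. }
      destruct (slope_bounded_neg lam a Hl Hv) as [C HC]. exists C.
      intros t Ht. rewrite Hux by trivial. apply HC. now apply HH.
Qed.
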